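(* Let $L$ be a quasiprimitive graph-restrictive permutation group of degree $d\ge 3$, with corresponding constant $c(L)$, let $k$ be a given positive integer, and let $p$ be any prime satisfying $p\ge k\,c(L)$. Suppose there exists a finite connected simple $G$-arc-transitive graph $\Gamma$ of order $kp^\alpha$, where $\alpha=1$ or $2$, such that $G_v^{\Gamma(v)}$ is permutation isomorphic to $L$, and let $P$ be a Sylow $p$-subgroup of $G$. Then the following hold: (a) The subgroup $P$ is normal in $G$, has order $p^\alpha$, and acts semiregularly on $V(\Gamma)$. (b) If $k\ge 3$, $\bar\Gamma=\Gamma/P$ and $\bar G=G/P$, then the natural projection $\Gamma\to\bar\Gamma$ is a regular covering projection, $\bar\Gamma$ has order $k$, and $\bar G$ is an arc-transitive and locally $L$ group of automorphisms of $\bar\Gamma$. (c) The stabiliser $G_v$ is isomorphic to a subgroup of $\mathrm{Aut}(P)$. (d) The degree $d$ of $L$ (the valency of $\Gamma$) is prime, and, writing $\bar G=G/P$, one of the following holds: (i) $P$ is cyclic, $p\equiv 1 \pmod{2d}$, $G_v^{\Gamma(v)}\cong C_d$, $|\bar G|=kd$, and $\bar G/[\bar G,\bar G]\cong C_{2d}$; (ii) $\alpha=2$, $P$ is elementary abelian of order $p^2$, and $G_v^{\Gamma(v)}\cong C_d$ or $D_d$.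
   Context: All graphs are finite, connected, simple and undirected. For a graph $\Gamma$, $V(\Gamma)$ is its vertex set; an arc is an ordered pair of adjacent vertices; the order of $\Gamma$ is $|V(\Gamma)|$; $\Gamma(v)$ is the neighbourhood of the vertex $v$. For a subgroup $G\le\mathrm{Aut}(\Gamma)$, $\Gamma$ is $G$-arc-transitive (and $G$ is an arc-transitive group of automorphisms) if $G$ is transitive on the arcs of $\Gamma$. $G_v$ is the stabiliser of the vertex $v$ in $G$, and $G_v^{\Gamma(v)}$ is the permutation group induced by $G_v$ on $\Gamma(v)$. A permutation group is semiregular if all its point stabilisers are trivial, and quasiprimitive if each of its non-trivial normal subgroups is transitive. $G$ is locally $L$ if $G_v^{\Gamma(v)}$ is permutation isomorphic to $L$ for some (hence every) vertex $v$. A transitive permutation group $L$ is graph-restrictive if there exists a constant $c=c(L)$ such that whenever $G$ is an arc-transitive, locally $L$ group of automorphisms of a (finite connected) graph $\Gamma$, we have $|G_v|\le c(L)$. For a subgroup $N\le \mathrm{Aut}(\Gamma)$, the quotient graph $\Gamma/N$ has as vertices the $N$-orbits on $V(\Gamma)$, two orbits being adjacent when there is an edge of $\Gamma$ between them. The natural projection $\Gamma\to\Gamma/N$ sends $v$ to its orbit $v^N$; it is called a regular covering projection if it maps $\Gamma(v)$ bijectively onto the neighbourhood of $v^N$ in $\Gamma/N$ for every $v\in V(\Gamma)$. The group $G/P$ acts on $\Gamma/P$ in the natural way. $C_n$ is the cyclic group of order $n$ and $D_n$ the dihedral group of order $2n$, each in its natural transitive action on $n$ points (when regarded as permutation groups).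 $[X,X]$ is the commutator subgroup of $X$. *)

(* Defs.v *)
From HB Require Import structures.
From mathcomp Require Import all_boot all_fingroup all_solvable zmodp.

Set Implicit Arguments.
Unset Strict Implicit.
Unset Printing Implicit Defensive.

Local Open Scope group_scope.

Definition connected_simple_graph (V : finType) (e : rel V) : Prop :=
  [/\ symmetric e, irreflexive e & forall x y : V, connect e x y].

Definition nbhd (V : finType) (e : rel V) (v : V) : {set V} := [set w | e v w].

Definition graph_aut (V : finType) (e : rel V) : {set {perm V}} :=
  [set g : {perm V} | [forall x, forall y, e (g x) (g y) == e x y]].

Definition arc_transitive (V : finType) (e : rel V) (G : {set {perm V}}) : Prop :=
  forall u v x y : V, e u v -> e x y ->
    exists g : {perm V}, [/\ g \in G, g u = x & g v = y].

Definition semiregular_perm_group (V : finType) (G : {set {perm V}}) : Prop :=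
  forall v : V, 'C_G[v | 'P] = 1.

(* Transitivity of L itself is part of graph-restrictiveness. *)
Definition quasiprimitive (W : finType) (L : {group {perm W}}) : Prop :=
  forall N : {group {perm W}}, N <| L -> N :!=: 1 ->
    [transitive N, on [set: W] | 'P].

(* A is a group of permutations of U that is trivial outside S, regarded as a
   permutation group on S. *)
Definition perm_isomorphic_on (U W : finType) (S : {set U})
    (A : {set {perm U}}) (L : {group {perm W}}) : Prop :=
  exists (f : W -> U) (phi : {morphism L >-> {perm U}}),
    [/\ injective f, f @: [set: W] = S, isom L A phi
      & forall (a : {perm W}) (w : W), a \in L -> f (a w) = phi a (f w)].

(* G_v^{Gamma(v)}, acting trivially outside Gamma(v). *)
Definition local_group (V : finType) (e : rel V) (G : {group {perm V}}) (v : V) :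
    {group {perm V}} :=
  (restr_perm (nbhd e v) @* 'C_G[v | 'P])%G.

Definition locally_at (V W : finType) (e : rel V) (G : {group {perm V}})
    (L : {group {perm W}}) (v : V) : Prop :=
  perm_isomorphic_on (nbhd e v) (local_group e G v) L.

(* For some v; equivalently for every v when G is arc-transitive. *)
Definition locally (V W : finType) (e : rel V) (G : {group {perm V}})
    (L : {group {perm W}}) : Prop :=
  exists v : V, locally_at e G L v.

(* L is graph-restrictive, and c is an admissible constant c(L). *)
Definition graph_restrictive (W : finType) (L : {group {perm W}}) (c : nat) : Prop :=
  [transitive L, on [set: W] | 'P] /\
  forall (V : finType) (e : rel V) (G : {group {perm V}}),
    connected_simple_graph e -> G \subset graph_aut e ->
    arc_transitive e G -> locally e G L ->
    forall v : V, (#|'C_G[v | 'P]| <= c)%N.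

Definition orbits (V : finType) (N : {set {perm V}}) : finType :=
  {B : {set V} | B \in orbit 'P N @: [set: V]}.

Definition to_orbit (V : finType) (N : {set {perm V}}) (x : V) : orbits N :=
  exist _ (orbit 'P N x) (imset_f (orbit 'P N) (in_setT x)).

Definition quotient_graph (V : finType) (e : rel V) (N : {set {perm V}}) :
    rel (orbits N) :=
  [rel B C : orbits N |
    (B != C) && [exists x in val B, exists y in val C, e x y]].
Arguments quotient_graph [V] e N _ _.

Definition regular_covering_projection (V : finType) (e : rel V)
    (N : {set {perm V}}) : Prop :=
  forall v : V,
    {in nbhd e v &, injective (@to_orbit V N)} /\
    @to_orbit V N @: nbhd e v = nbhd (quotient_graph e N) (to_orbit N v).

(* For N normal in G this determines phi. *)
Definition natural_action (V : finType) (G N : {group {perm V}})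
    (phi : {morphism G / N >-> {perm (orbits N)}}) : Prop :=
  forall (g : {perm V}) (x : V), g \in G ->
    phi (coset N g) (to_orbit N x) = to_orbit N (g x).

Definition cyclic_perm_group (n : nat) : {group {perm 'I_n}} :=
  <<[set perm (@ordS_inj n)]>>%G.

(* rev_ord is the reflection i |-> n - 1 - i of the n-cycle. *)
Definition dihedral_perm_group (n : nat) : {group {perm 'I_n}} :=
  <<[set perm (@ordS_inj n); perm (@rev_ord_inj n)]>>%G.

(* Main.v *)
(* The order of G is k |G_v| p^alpha, and k |G_v| <= p is prime to p (otherwise G
   would have odd order, which an arc reversal forbids), so P is normal of order
   p^alpha, hence abelian.  A normal subgroup N of G either has all N_v trivial,
   or has every N_v transitive on neighbours and then at most two orbits.

   C_G(P) = P x Q with Q a p'-group; Q cannot have at most two orbits, so G_v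
   acts faithfully on P.  If P is cyclic, then G_v is abelian, hence of prime
   order d, and G is generated by G_v and an involution t reversing an arc;
   t does not centralise P, since otherwise t is in Q and G = Q G_v is a p'-group.

   If P is elementary abelian of order p^2, then G_v is a p'-subgroup of GL_2(p).
   If its scalars are transitive on neighbours, they induce the whole local group.
   If it has no scalars, an element a and a conjugate of a commuting with it
   are equal or mutually inverse, by comparing traces and determinants; a class
   count then shows that the odd-order subgroup of elements of determinant 1 is
   abelian.  All its subgroups are normal in G_v, so if it is transitive on
   neighbours, it induces C_d with d prime and the local group is C_d or D_d.

   Since d is prime, the P-orbits meet each neighbourhood in at most one point,
   which gives the covering. *)
Require Import Defs.
From HB Require Import structures.
From mathcomp Require Import all_boot all_fingroup all_solvable all_algebra all_character zmodp ring.

Set Implicit Arguments.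
Unset Strict Implicit.
Unset Printing Implicit Defensive.

Import GRing.Theory.

Local Open Scope group_scope.

(** * Odd groups partitioned by abelian centralisers *)

Lemma odd_no_involution (gT : finGroupType) (K : {group gT}) :
  (forall x, x \in K -> x ^+ 2 = 1 -> x = 1) -> odd #|K|.
Proof.
move=> noinv; apply/negPn/negP; rewrite -dvdn2 => /Cauchy[] // x Kx ox.
have x1 : x = 1 by apply: noinv => //; rewrite -ox expg_order.
by rewrite x1 order1 in ox.
Qed.

Section OddPartition.

Variables (gT : finGroupType) (K : {group gT}).
Hypotheses (oddK : odd #|K|)
  (abC : forall a, a \in K -> a != 1 -> abelian 'C_K[a])
  (conjC : forall a g, a \in K -> a != 1 -> g \in K -> a ^ g \in 'C[a] ->
             a ^ g = a \/ a ^ g = a^-1).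

(** If [g] inverts [a], then [g ^+ 2] centralises [a], and [g], being of odd order, is a power of
    [g ^+ 2]. *)
Lemma conj_centralizer a g :
  a \in K -> a != 1 -> g \in K -> a ^ g \in 'C[a] -> g \in 'C[a].
Proof.
move=> Ka a1 Kg /(conjC Ka a1 Kg)[/conjg_fixP/commgP cag|ag].
  by apply/cent1P; apply: commute_sym.
have cg2: (g ^+ 2) \in 'C[a].
  apply/cent1P/commute_sym/commgP/conjg_fixP.
  by rewrite expgS expg1 conjgM ag conjVg ag invgK.
suff: g \in <[g ^+ 2]> by apply/subsetP; rewrite cycle_subG.
have: generator <[g]> (g ^+ 2).
  by rewrite generator_coprime coprimen2 (dvdn_odd (order_dvdG Kg)).
by move/eqP <-; rewrite cycle_id.
Qed.

(** Abelian centralisers make commutation transitive on non-trivial elements, so distinct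
    centralisers meet trivially. *)
Lemma eq_cent1 a b : a \in K -> a != 1 -> b \in 'C_K[a] -> b != 1 -> 'C_K[a] = 'C_K[b].
Proof.
move=> Ka a1 Cb b1.
have sub x y : x \in K -> x != 1 -> y \in 'C_K[x] -> 'C_K[x] \subset 'C_K[y].
  move=> Kx x1 Cy; rewrite subsetI subsetIl /= sub_cent1.
  by apply: subsetP (y) Cy; apply: abC.
apply/eqP; rewrite eqEsubset !sub //; first by case/setIP: Cb.
by rewrite inE Ka cent1C; case/setIP: Cb.
Qed.

(** An element taking a non-trivial element of the centraliser back into it must centralise that
    element. So the centraliser is its own normaliser and meets its other conjugates trivially,
    which lets its conjugates be counted. *)
Lemma normedTI_cent1 a : a \in K -> a != 1 -> normedTI ('C_K[a])^# K 'C_K[a].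
Proof.
move=> Ka a1; apply/normedTI_memJ_P; split; last 1 first.
- move=> b g /setD1P[b1 Cb] Kg; have Kb : b \in K by case/setIP: Cb.
  rewrite /= (eq_cent1 Ka a1 Cb b1) in_setD1 !in_setI conjg_eq1 b1 groupJ ?Kg //=.
  apply/idP/idP => [|cg]; first exact: conj_centralizer.

  by rewrite conjgE -(cent1P cg) mulKg cent1id.
- by apply/set0Pn; exists a; rewrite in_setD1 in_setI a1 Ka cent1id.
- exact: subsetIl.
Qed.

(* If K is not abelian, the conjugates of the centralisers of two
   non-conjugate elements already cover more than |K| - 1 elements. *)
Lemma odd_partition_abelian : abelian K.
Proof.
apply: contraT => nab.
have ltC a : a \in K -> a != 1 -> (1 < #|K : 'C_K[a]|)%N.
  move=> Ka a1; rewrite indexg_gt1; apply: contra nab => sKC.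
  by apply: abelianS sKC (abC Ka a1).
(* There are |K : C| conjugates of the centraliser C, each with |C| - 1 non-trivial elements. *)
have cardS a : a \in K -> a != 1 ->
    (#|class_support ('C_K[a])^# K| + #|K : 'C_K[a]| = #|K|)%N.
  move=> Ka a1; rewrite (card_support_normedTI (normedTI_cent1 Ka a1)).
  by rewrite -mulSnr -[RHS](Lagrange (subsetIl K 'C[a])) [in RHS](cardsD1 1) group1.
have halfK a : a \in K -> a != 1 -> (#|K : 'C_K[a]|.*2 <= #|K|)%N.
  move=> Ka a1; rewrite -(Lagrange (subsetIl K 'C[a])) -mul2n leq_mul2r.
  rewrite orbC cardG_gt1; apply/orP; left.
  by apply/trivgPn; exists a => //; rewrite in_setI Ka cent1id.
have K1 : K :!=: 1 by apply: contraNneq nab => ->; apply: abelian1.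
have [a Ka a1] := trivgPn _ K1.
have sS x : x \in K -> class_support ('C_K[x])^# K \subset K^#.
  move=> Kx; apply/subsetP=> _ /imset2P[y g /setD1P[y1 /setIP[Ky _]] Kg ->].
  by rewrite !inE conjg_eq1 y1 groupJ.
have cK: #|K| = #|K^#|.+1 by rewrite [LHS](cardsD1 1) group1.
have: class_support ('C_K[a])^# K \proper K^#.
  rewrite properEcard sS // -ltnS -cK -(cardS a Ka a1) -addn1 ltn_add2l.
  exact: ltC.
case/properP=> _ [b /setD1P[b1 Kb] nSb].
(* By [eq_cent1], a common element would identify one centraliser with a conjugate of the other, and
   [b] would already be covered. *)
have dis : [disjoint class_support ('C_K[a])^# K & class_support ('C_K[b])^# K].
  rewrite -setI_eq0; apply: contraNT nSb => /set0Pn[c /setIP[]].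
  case/imset2P=> x g /setD1P[x1 Cx] Kg -> /imset2P[y h /setD1P[y1 Cy] Kh defc].
  have defx : x = y ^ (h * g^-1) by rewrite conjgM -defc conjgK.
  have Ku : h * g^-1 \in K by rewrite groupM ?groupV.
  have Cyb : b \in 'C_K[y] by rewrite -(eq_cent1 Kb b1 Cy y1) inE Kb cent1id.
  apply/imset2P; exists (b ^ (h * g^-1)) (g * h^-1); rewrite ?groupM ?groupV //.
    rewrite in_setD1 conjg_eq1 b1 (eq_cent1 Ka a1 Cx x1) defx in_setI.
    by rewrite (groupJ Kb Ku) cent1J memJ_conjg; case/setIP: Cyb.
  by rewrite -conjgM mulgA mulgKV mulgV conjg1.
have := subset_leq_card (_ :
  class_support ('C_K[a])^# K :|: class_support ('C_K[b])^# K \subset K^#).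
rewrite subUset !sS // => /(_ isT); rewrite cardsU (disjoint_setI0 dis) cards0 subn0.
(* Both indices are at most |K| / 2, so the two supports together have at least |K| elements, one
   more than [K^#]. *)
rewrite -ltnS -cK ltnNge -(leq_add2r (#|K : 'C_K[a]| + #|K : 'C_K[b]|)).
rewrite addnACA !cardS // leq_add2l => /negP[].
by rewrite -leq_double doubleD -(addnn #|K|) leq_add ?halfK.
Qed.

End OddPartition.

(** * Linear p'-groups of degree 2 *)

Section Matrix2.

Local Open Scope ring_scope.

Variable F : fieldType.
Implicit Types A B : 'M[F]_2.

Lemma matrix2P A B :
  A 0%R 0%R = B 0%R 0%R -> A 0%R 1%R = B 0%R 1%R ->
  A 1%R 0%R = B 1%R 0%R -> A 1%R 1%R = B 1%R 1%R -> A = B.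
Proof.
have ordE (i : 'I_2) : i = 0%R \/ i = 1%R.
  by case: i => [[|[|//]] ?]; [left | right]; apply: val_inj.
move=> e00 e01 e10 e11; apply/matrixP=> i j.
by case: (ordE i) (ordE j) => -> [] ->.
Qed.

Lemma mulmx2E A B i j : (A *m B) i j = (A i 0 * B 0 j + A i 1 * B 1 j)%R.
Proof.
by rewrite mxE !big_ord_recl big_ord0 addr0; congr (_ + A _ _ * B _ _)%R; apply: val_inj.
Qed.

Lemma mxtrace2E A : (\tr A = A 0 0 + A 1 1)%R.
Proof.
by rewrite /mxtrace !big_ord_recl big_ord0 addr0; congr (_ + A _ _)%R; apply: val_inj.
Qed.

Lemma det2E A : (\det A = A 0 0 * A 1 1 - A 0 1 * A 1 0)%R.
Proof.
rewrite (expand_det_row _ 0%R) !big_ord_recl big_ord0 /cofactor !det_mx11 !mxE /=.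
rewrite expr0 expr1 addr0 mul1r mulN1r mulrN.
by congr (_ * A _ _ - A _ _ * A _ _)%R; apply: val_inj.
Qed.

Lemma scalar2P A : reflect [/\ A 0 1 = 0, A 1 0 = 0 & A 0 0 = A 1 1] (is_scalar_mx A).
Proof.
apply: (iffP is_scalar_mxP) => [[c ->]|[e01 e10 e00]]; first by rewrite !mxE.
by exists (A 0 0); apply: matrix2P; rewrite !mxE /= ?e01 ?e10 ?e00.
Qed.

Lemma commute2_coef (a b c d x y z w : F) :
  ~ [/\ b = 0, c = 0 & a = d] -> b * z = y * c ->
  a * y + b * w = x * b + y * d -> c * x + d * z = z * a + w * c ->
  exists s t, [/\ x = s * a + t, y = s * b, z = s * c & w = s * d + t].
Proof.
move=> ns e1 e2 e3.
have [b0|nb] := eqVneq b 0; last first.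
  exists (y / b), (x - y / b * a); split; first by rewrite addrC subrK.
  - by rewrite divfK.
  - by apply: (mulfI nb); rewrite e1; field.
  apply: (mulfI nb); rewrite (_ : b * w = x * b + y * d - a * y); last by rewrite -e2; ring.
  by field.
have [c0|nc] := eqVneq c 0; last first.
  exists (z / c), (x - z / c * a); split; first by rewrite addrC subrK.
  - by apply/eqP; rewrite -(inj_eq (mulIf nc)) -e1 b0 mulr0 !mul0r.
  - by rewrite divfK.
  apply: (mulfI nc); rewrite (_ : c * w = c * x + d * z - z * a); last by rewrite e3; ring.
  by field.
have nad : a - d != 0 by rewrite subr_eq0; apply/eqP=> ad; apply: ns.
move: e2 e3; rewrite b0 c0 !mul0r !mulr0 !addr0 !add0r => e2 e3.
exists ((x - w) / (a - d)), (x - (x - w) / (a - d) * a); split.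
- by rewrite addrC subrK.
- by apply: (mulfI nad); rewrite mulr0 mulr0 mulrBl e2; ring.
- by apply: (mulfI nad); rewrite mulr0 mulr0 mulrBl e3; ring.
- by field.
Qed.

Lemma commute_nonscalar2 A B : ~~ is_scalar_mx A -> A *m B = B *m A ->
  exists s t, B = s *: A + t%:M.
Proof.
move=> nsA /matrixP cAB.
have := cAB 0 0; have := cAB 0 1; have := cAB 1 0; rewrite !mulmx2E => c10 c01 c00.
have [|||| s [t [e00 e01 e10 e11]]] := commute2_coef (a := A 0 0) (d := A 1 1)
  (b := A 0 1) (c := A 1 0) (x := B 0 0) (y := B 0 1) (z := B 1 0) (w := B 1 1).
- by move=> sA; case/negP: nsA; apply/scalar2P.
- by apply: (addrI (A 0 0 * B 0 0)); rewrite c00 mulrC.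
- by [].
- by [].
by exists s, t; apply: matrix2P; rewrite !mxE ?mulr1n ?mulr0n ?addr0.
Qed.

Lemma CayleyHamilton2 A : A *m A = \tr A *: A - (\det A)%:M.
Proof.
by rewrite mxtrace2E det2E; apply: matrix2P; rewrite mulmx2E !mxE /= ?mulr1n ?mulr0n; ring.
Qed.

(* [B = s A + t]; comparing traces and determinants gives [(s^2 - 1) disc A = 0]. *)
Lemma conjugate_in_centralizer2 A B : (2%:R != 0 :> F) ->
    ~~ is_scalar_mx A -> (\tr A) ^+ 2 - 4%:R * \det A != 0 ->
    A *m B = B *m A -> \tr B = \tr A -> \det B = \det A ->
  B = A \/ A *m B = (\det A)%:M.
Proof.
move=> n2 nsA disc cAB; have [s [t defB]] := commute_nonscalar2 nsA cAB.
set T := \tr A in disc *; set D := \det A in disc *.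
have trB : \tr B = s * T + 2%:R * t.
  by rewrite defB mxtraceD mxtraceZ mxtrace_scalar mulr_natl.
have detB : \det B = s ^+ 2 * D + s * t * T + t ^+ 2.
  by rewrite defB /T /D mxtrace2E !det2E !mxE /= ?mulr1n ?mulr0n; ring.
rewrite trB detB => eT eD.
have : (s - 1) * (s + 1) * (T ^+ 2 - 4%:R * D) = 0.
  have e2t : 2%:R * t = T - s * T by rewrite -{1}eT; ring.
  (* This identity eliminates [t]: the bracket vanishes by [eD], and the other two terms cancel once
     2t = (1 - s)T. *)
  rewrite (_ : _ * _ = - 4%:R * (s ^+ 2 * D + s * t * T + t ^+ 2 - D)
    + (2%:R * t) * (2%:R * s * T + 2%:R * t) + (s ^+ 2 - 1) * T ^+ 2); last by ring.
  by rewrite e2t eD; ring.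
move/eqP; rewrite !mulf_eq0 (negPf disc) orbF subr_eq0 addr_eq0 => /orP[]/eqP es.
  left; have t0 : t = 0.
    by apply: (mulfI n2); rewrite mulr0; move: eT; rewrite es mul1r -{2}[T]addr0 => /addrI.
  by rewrite defB es t0 scale1r; apply: matrix2P; rewrite !mxE /= ?mul0rn ?addr0.
(* For s = -1 the equation of traces gives B = T - A, and AB = D is the Cayley-Hamilton identity. *)
right; have et : t = T.
    have e2 : 2%:R * t = T - s * T by rewrite -{1}eT; ring.
    by apply: (mulfI n2); rewrite e2 es; ring.
rewrite defB es et mulmxDr -scalemxAr CayleyHamilton2 -/T -/D mul_mx_scalar scaleN1r.
by apply: matrix2P; rewrite !mxE /=; ring.
Qed.

Lemma unipotent_expr2 (h : F) (N : 'M[F]_2) n : N * N = 0 ->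
  (h%:M + N) ^+ n.+1 = (h ^+ n.+1)%:M + (n.+1%:R * h ^+ n) *: N.
Proof.
move=> N2; elim: n => [|n IHn]; first by rewrite !expr1 expr0 mulr1 scale1r.
rewrite exprS {}IHn mulrDl !mulrDr -!scalerAr N2 scaler0 addr0.
rewrite -[h%:M * (_)%:M]scalar_mxM -exprS -addrA; congr (_ + _).
rewrite [N * _]mul_mx_scalar [_ * N]mul_scalar_mx scalerA -scalerDl; congr (_ *: _).
by rewrite [n.+2%:R]mulrS exprS; ring.
Qed.

(** With a double eigenvalue h, the matrix N = A - h squares to zero, and the two-term binomial
    expansion of A^n = 1 makes n h^(n-1) N scalar. Since n is invertible in [F], A would be
    scalar. *)
Lemma discriminant2_neq0 A n : 2%:R != 0 :> F -> n%:R != 0 :> F -> A ^+ n = 1 ->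
  ~~ is_scalar_mx A -> (\tr A) ^+ 2 - 4%:R * \det A != 0.
Proof.
case: n => [|n]; first by rewrite eqxx.
move=> n2 n0 An nsA; apply: contra nsA; rewrite subr_eq0 => /eqP disc.
set h := \tr A / 2%:R; set N := A - h%:M.
have Dh : \det A = h ^+ 2.
  have n4 : 4%:R != 0 :> F by rewrite (natrM F 2 2) mulf_neq0.
  by apply: (mulfI n4); rewrite -disc /h; field.
have T2h : \tr A = 2%:R * h by rewrite mulrC divfK.
have N2 : N * N = 0.
  rewrite /N mulrBl !mulrBr [A * A]CayleyHamilton2 T2h Dh.
  rewrite -[h%:M * h%:M]scalar_mxM [h%:M * A]mul_scalar_mx [A * h%:M]mul_mx_scalar.
  by apply: matrix2P; rewrite !mxE /= ?mulr1n ?mulr0n; ring.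
(* For h = 0 the matrix A itself squares to zero although a power of it is 1, so A = 0, which is
   scalar. *)
have [h0|h0] := eqVneq h 0.
  have defA : A = N by rewrite /N h0 raddf0 subr0.
  have : A ^+ n.+1 * A = 0 by rewrite exprSr -mulrA defA N2 mulr0.
  by rewrite An mul1r => ->; apply/is_scalar_mxP; exists 0; rewrite raddf0.
have defA : A = h%:M + N by rewrite addrC subrK.
move: An; rewrite defA (unipotent_expr2 _ _ N2) => /(canRL (addKr _)) eN.
have c0 : n.+1%:R * h ^+ n != 0 by rewrite mulf_neq0 ?expf_neq0.
apply/is_scalar_mxP; exists (h + (n.+1%:R * h ^+ n)^-1 * (1 - h ^+ n.+1)).
rewrite raddfD /=; congr (_ + _); apply: (scalerI c0).
rewrite eN scale_scalar_mx mulrA mulfV // mul1r.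
by rewrite raddfB /= addrC.
Qed.

End Matrix2.

(** * Groups of 2 by 2 matrices without non-trivial scalars *)

Section NoScalars.

Variables (gT : finGroupType) (G H : {group gT}) (F : fieldType).
Variable rG : mx_representation F G 2.
Hypotheses (sHG : H \subset G) (n2 : (2%:R != 0 :> F)%R) (nH : (#|H|%:R != 0 :> F)%R)
  (nscal : forall x, x \in H -> is_scalar_mx (rG x) -> x = 1).

Let sG x : x \in H -> x \in G. Proof. exact: (subsetP sHG). Qed.

Lemma no_scalars_inj : {in H &, injective rG}.
Proof.
move=> x y Hx Hy exy; apply: (mulIg y^-1); rewrite mulgV; apply: nscal.
  by rewrite groupM ?groupV.
by rewrite repr_mxM ?groupV ?sG // exy -repr_mxM ?groupV ?sG // mulgV repr_mx1 scalar_mx_is_scalar.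
Qed.

Lemma commute_repr x y : x \in H -> y \in H ->
  x \in 'C[y] -> (rG x *m rG y = rG y *m rG x)%R.
Proof. by move=> Hx Hy /cent1P cxy; rewrite -!repr_mxM ?sG // cxy. Qed.

(** An element commuting with the non-scalar [a] is a polynomial in [a], hence commutes with all
    that [a] commutes with. *)
Lemma no_scalars_abelian_cent1 a : a \in H -> a != 1 -> abelian 'C_H[a].
Proof.
move=> Ha a1; apply/centsP=> x /setIP[Hx cx] y /setIP[Hy cy].
have nsa : ~~ is_scalar_mx (rG a) by apply: contra a1 => /nscal->.
have [s [t ex]] := commute_nonscalar2 nsa (esym (commute_repr Hx Ha cx)).
apply: no_scalars_inj; rewrite ?groupM // !repr_mxM ?sG // ex.
rewrite mulmxDl mulmxDr -scalemxAl -scalemxAr (commute_repr Hy Ha cy).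
by rewrite scalar_mxC.
Qed.

(** Conjugates share trace and determinant, so [conjugate_in_centralizer2] applies. In its second
    case [a * a ^ g] is scalar, hence trivial. *)
Lemma no_scalars_conj a g : a \in H -> a != 1 -> g \in H -> a ^ g \in 'C[a] ->
  a ^ g = a \/ a ^ g = a^-1.
Proof.
move=> Ha a1 Hg cag; have Hag : a ^ g \in H by rewrite groupJ.
have nsa : ~~ is_scalar_mx (rG a) by apply: contra a1 => /nscal->.
have Vg : (rG (g^-1)%g *m rG g = 1%:M)%R by rewrite -repr_mxM ?groupV ?sG // mulVg repr_mx1.
have eag : (rG (a ^ g)%g = rG (g^-1)%g *m (rG a *m rG g))%R.
  by rewrite conjgE !repr_mxM ?groupM ?groupV ?sG.
case: (@conjugate_in_centralizer2 F (rG a) (rG (a ^ g)) n2 nsa).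
- apply: (discriminant2_neq0 n2 nH _ nsa).
  by rewrite -repr_mxX ?sG // expg_cardG // repr_mx1.
- exact/esym/commute_repr.
- by rewrite eag mxtrace_mulC -mulmxA -repr_mxM ?groupV ?sG // mulgV repr_mx1 mulmx1.
- by rewrite eag !det_mulmx mulrCA -det_mulmx Vg det1 mulr1.
- by left; apply: no_scalars_inj.
move=> eD; right; apply/eqP; rewrite eq_sym eq_invg_mul; apply/eqP/nscal.
  by rewrite groupM.
by rewrite repr_mxM ?sG // eD scalar_mx_is_scalar.
Qed.

(** An involution x of determinant 1 would satisfy tr(x) x = 2 by Cayley-Hamilton and so be scalar.
    Hence [K] has odd order and [odd_partition_abelian] applies. *)
Lemma no_scalars_det1_abelian (K : {group gT}) : K \subset H ->
  {in K, forall x, (\det (rG x) = 1)%R} -> abelian K.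
Proof.
move=> sKH det1K; have sK x : x \in K -> x \in H by apply: (subsetP sKH).
apply: odd_partition_abelian => [|a Ka a1|a g Ka a1 Kg].
- apply: odd_no_involution => x Kx x2; apply/eqP; apply: contraT => x1.
  have nsx : ~~ is_scalar_mx (rG x) by apply: contra x1 => /(nscal (sK x Kx))->.
  have := CayleyHamilton2 (rG x).
  rewrite det1K // -repr_mxM ?sG ?sK // -[x * x]/(x ^+ 2) x2 repr_mx1 => /esym/(canRL (subrK _)).
  have [-> /matrixP/(_ 0 0)%R|tr0 etr] := eqVneq (\tr (rG x))%R 0%R.
    by rewrite scale0r !mxE /= -mulr2n => /esym/eqP; rewrite (negPf n2).
  case/negP: nsx; rewrite -[rG x]scale1r -(mulVf tr0) -scalerA etr -raddfD.
  by rewrite scale_scalar_mx scalar_mx_is_scalar.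
- by apply: abelianS (no_scalars_abelian_cent1 (sK a Ka) a1); rewrite setSI.
by apply: no_scalars_conj; rewrite ?sK.
Qed.

End NoScalars.

(** * Kernel of the determinant *)

Section DetKernel.

Variables (F : fieldType) (gT : finGroupType) (G : {group gT}) (n : nat).
Variable rG : mx_representation F G n.

Lemma det_reprJ x g : x \in G -> g \in G -> (\det (rG (x ^ g)%g) = \det (rG x))%R.
Proof.
move=> Gx Gg; rewrite conjgE !repr_mxM ?groupM ?groupV // !det_mulmx mulrCA.
by rewrite -det_mulmx -repr_mxM ?groupV // mulVg repr_mx1 det1 mulr1.
Qed.

Definition det1_set : {set gT} := [set x in G | (\det (rG x) == 1)%R].

Lemma det1_group_set : group_set det1_set.
Proof.
apply/group_setP; split=> [|x y]; first by rewrite inE group1 repr_mx1 det1 eqxx.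
rewrite !inE => /andP[Gx /eqP dx] /andP[Gy /eqP dy].
by rewrite groupM // repr_mxM // det_mulmx dx dy mul1r eqxx.
Qed.

Canonical det1_group := Group det1_group_set.

Lemma det1_normal : det1_set <| G.
Proof.
apply/andP; split; first by apply/subsetP=> x /setIdP[].
apply/subsetP=> g Gg; rewrite inE; apply/subsetP=> _ /imsetP[x /setIdP[Gx dx] ->].
by rewrite inE groupJ //= det_reprJ.
Qed.

End DetKernel.

(** * Quasiprimitive permutation groups *)

Section ExtendPerm.

Variables (W U : finType) (f : W -> U).
Hypothesis injf : injective f.

(** The identity outside the image of [f] agrees with the convention of [restr_perm], so that the
    image of L can equal the local group itself. *)
Definition extend_fun (s : {perm W}) (x : U) : U :=
  if [pick w | f w == x] is Some w then f (s w) else x.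

Lemma extend_fun_im s w : extend_fun s (f w) = f (s w).
Proof.
by rewrite /extend_fun; case: pickP => [w' /eqP/injf->|/(_ w)/eqP].
Qed.

Lemma extend_fun_out s x : x \notin f @: setT -> extend_fun s x = x.
Proof.
rewrite /extend_fun; case: pickP => // w /eqP<- /negP[].
by rewrite imset_f ?inE.
Qed.

Lemma extend_fun_inj s : injective (extend_fun s).
Proof.
apply: (can_inj (g := extend_fun s^-1)) => x.
have [/imsetP[w _ ->]|nx] := boolP (x \in f @: setT); last by rewrite !extend_fun_out.
by rewrite !extend_fun_im permK.
Qed.

Definition extend_perm s := perm (@extend_fun_inj s).

Lemma extend_permE s w : extend_perm s (f w) = f (s w).
Proof. by rewrite permE extend_fun_im. Qed.

Lemma extend_perm_out s x : x \notin f @: setT -> extend_perm s x = x.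
Proof. by move=> nx; rewrite permE extend_fun_out. Qed.

Lemma extend_permP (s : {perm W}) (g : {perm U}) :
    perm_on (f @: setT) g -> (forall w, g (f w) = f (s w)) -> g = extend_perm s.
Proof.
move=> ong gf; apply/permP=> x.
have [/imsetP[w _ ->]|nx] := boolP (x \in f @: setT); first by rewrite gf extend_permE.
by rewrite extend_perm_out // (out_perm ong).
Qed.

Lemma extend_permM : {in setT &, {morph extend_perm : s t / s * t}}.
Proof.
move=> s t _ _; apply/esym/extend_permP => [|w]; last first.
  by rewrite permM !extend_permE permM.
apply/subsetP=> x; rewrite inE; apply: contraR => nx.
by rewrite permM !extend_perm_out.
Qed.

Canonical extend_perm_morphism := Morphism extend_permM.

Lemma injm_extend_perm : 'injm extend_perm.
Proof.
apply/injmP=> s t _ _ est; apply/permP=> w; apply: injf.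
by rewrite -!extend_permE est.
Qed.

Lemma perm_isomorphic_onI (L : {group {perm W}}) (A : {group {perm U}}) S :
  f @: setT = S -> extend_perm @* L = A -> perm_isomorphic_on S A L.
Proof.
move=> defS defA; exists f, (restrm_morphism (subsetT L) extend_perm_morphism).
split=> // [|a w La]; last by rewrite /= /restrm extend_permE.
by apply/isomP; rewrite injm_restrm ?injm_extend_perm ?morphim_restrm ?setIid.
Qed.

End ExtendPerm.

(** Local groups consist of permutations of all of [V], so the set on which they are quasiprimitive
    has to be named. *)
Definition quasiprimitive_on (V : finType) (A : {group {perm V}}) (S : {set V}) :=
  [transitive A, on S | 'P] /\
  forall N : {group {perm V}}, N <| A -> N :!=: 1 -> [transitive N, on S | 'P].

(** * Abelian transitive subgroups of quasiprimitive groups *)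

Section AbelianTransitive.

Variables (V : finType) (S : {set V}).
Implicit Types (A K : {group {perm V}}).

(** [K] permutes the fixed points of [g] and is transitive on [S]. *)
Lemma cent_transitive_semiregular K g w : w \in S -> perm_on S g ->
  [transitive K, on S | 'P] -> g \in 'C(K) -> g w = w -> g = 1.
Proof.
move=> Sw ong trK /centP cKg gw; apply/permP=> y; rewrite perm1.
have [Sy|/(out_perm ong)//] := boolP (y \in S).
have [k Kk ->] := atransP2 trK Sw Sy.
by rewrite /= apermE -permM -(cKg k Kk) permM gw.
Qed.

Variables (A K : {group {perm V}}) (d : nat).
Hypotheses (cardS : #|S| = d) (d3 : (2 < d)%N)
  (onA : {in A, forall a, perm_on S a}) (qpA : quasiprimitive_on A S)
  (sKA : K \subset A) (abK : abelian K) (trK : [transitive K, on S | 'P])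
  (conjK : {in K & A, forall a g, a ^ g = a \/ a ^ g = a^-1}).

Let onK : {in K, forall a, perm_on S a}.
Proof. by move=> a Ka; apply: onA; apply: (subsetP sKA). Qed.

(** An abelian transitive group centralises itself, so its point stabilisers are trivial. *)
Lemma card_abelian_transitive (H : {group {perm V}}) : H \subset K ->
  [transitive H, on S | 'P] -> #|H| = d.
Proof.
move=> sHK trH; have /card_gt0P[w Sw] : (0 < #|S|)%N by rewrite cardS (leq_trans _ d3).
rewrite -(card_orbit_stab 'P H w) (atransP trH) // cardS.
rewrite (_ : 'C_H[w | 'P] = 1) ?cards1 ?muln1 //; apply/trivgP/subsetP=> h /setIP[Hh /astab1P hw].
apply/set1P; apply: (cent_transitive_semiregular Sw _ trH) => //.
  exact/onK/(subsetP sHK).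
by apply: (subsetP (abelianS sHK abK)).
Qed.

(** By [conjK] the subgroup [<[a]>] is normal in [A], so quasiprimitivity makes it transitive, and
    it has the same order d as [K]. *)
Lemma order_abelian_transitive a : a \in K -> a != 1 -> <[a]> = K /\ #[a] = d.
Proof.
move=> Ka a1.
have trA : [transitive <[a]>, on S | 'P].
  apply: qpA.2; last by rewrite cycle_eq1.
  rewrite /normal cycle_subG (subsetP sKA) //=; apply/subsetP=> g Ag.
  rewrite inE -cycleJ cycle_subG.
  by case: (conjK Ka Ag) => ->; rewrite ?groupV cycle_id.
have sAK : <[a]> \subset K by rewrite cycle_subG.
have oa := card_abelian_transitive sAK trA.
split=> //; apply/eqP; rewrite eqEcard sAK oa.
by rewrite (card_abelian_transitive (subxx K) trK) leqnn.
Qed.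

(** All non-trivial elements of [K] have order d, and Cauchy's theorem supplies one of prime
    order. *)
Lemma prime_abelian_transitive : prime d.
Proof.
have cK := card_abelian_transitive (subxx K) trK.
have dq : pdiv d %| #|K| by rewrite cK pdiv_dvd.
have prq : prime (pdiv d) by rewrite pdiv_prime // ltnW.
have [x Kx ox] := Cauchy prq dq.
have x1 : x != 1 by rewrite -order_gt1 ox prime_gt1.
by have [_ <-] := order_abelian_transitive Kx x1; rewrite ox.
Qed.

(* Label the points of [S] by the powers of a generator [a] of [K]; an element
   of [A] either centralises [a], and then lies in <[a]>, or inverts it. *)
Lemma cyclic_or_dihedral :
  perm_isomorphic_on S A (cyclic_perm_group d) \/
  ~~ abelian A /\ perm_isomorphic_on S A (dihedral_perm_group d).
Proof.
have cK := card_abelian_transitive (subxx K) trK.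
have [a Ka a1] : exists2 a, a \in K & a != 1.
  by apply/trivgPn; rewrite -cardG_gt1 cK ltnW.
have [defK oa] := order_abelian_transitive Ka a1.
have /card_gt0P[w Sw] : (0 < #|S|)%N by rewrite cardS (leq_trans _ d3).
have Aa := subsetP sKA a Ka.
pose f (i : 'I_d) := (a ^+ i) w.
have injf : injective f.
  move=> i j eij; apply/val_inj/eqP.
  have: a ^+ i * (a ^+ j)^-1 = 1.
    have Kij : a ^+ i * (a ^+ j)^-1 \in K by rewrite groupM ?groupV ?groupX.
    apply: (cent_transitive_semiregular Sw (onK Kij) trK).
      by apply: (subsetP abK).
    by rewrite permM [(a ^+ i) w]eij permK.
  move/(canRL (mulgKV _)); rewrite mul1g => /eqP.
  by rewrite eq_expg_mod_order oa !modn_small.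
have imf : f @: setT = S.
  apply/eqP; rewrite eqEcard card_imset // cardsT card_ord cardS leqnn andbT.
  by apply/subsetP=> _ /imsetP[i _ ->]; rewrite perm_closed ?onK ?groupX.
have ext_rot : extend_perm injf (perm (@ordS_inj d)) = a.
  apply/esym/extend_permP => [|i]; rewrite ?imf ?onK // permE /f -permM -expgSr.
  by rewrite -(expg_mod_order a i.+1) oa.
have centA g : g \in A -> a ^ g = a -> g \in <[a]>.
  move=> Ag /conjg_fixP/commgP/commute_sym/cent1P cag.
  have Sgw : g w \in S by rewrite perm_closed ?onA.
  have [k Kk ek] := atransP2 trK Sw Sgw; rewrite defK.
  suff: g * k^-1 = 1 by move/(canRL (mulgKV _)); rewrite mul1g => ->.
  apply: (cent_transitive_semiregular Sw _ trK).
  - by rewrite onA // groupM ?groupV // (subsetP sKA).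
  - rewrite -defK cent_cycle groupM ?groupV //.
    by have := subsetP abK k Kk; rewrite -defK cent_cycle.
  by rewrite permM ek /= apermE permK.
have [cA|] := boolP [forall g in A, a ^ g == a].
  left; apply: (perm_isomorphic_onI (injf := injf)) => //.
  rewrite morphim_gen ?subsetT // morphim_set1 ?inE //= ext_rot.
  apply/eqP; rewrite eqEsubset gen_subG sub1set Aa; apply/subsetP=> g Ag.
  by apply: centA => //; apply/eqP; have /forall_inP := cA; apply.
rewrite negb_forall_in => /exists_inP[h0 Ah0 nah0]; right.
have ah0 : a ^ h0 = a^-1 by case: (conjK Ka Ah0) nah0 => // ->; rewrite eqxx.
have Sh0 : h0 w \in S by rewrite perm_closed ?onA.
have Sa : a^-1 w \in S by rewrite perm_closed ?onK ?groupV.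
(* [rev_ord] sends 0 to d - 1, so the reflection must send [w] to [a^-1 w]; the element [k] corrects
   [h0] to do so and still centralises [a]. *)
have [k Kk ek] := atransP2 trK Sh0 Sa.
pose h := h0 * k; have Ah : h \in A by rewrite groupM // (subsetP sKA).
have cak : a ^ k = a by apply/conjg_fixP/commgP; exact: (centsP abK _ Ka _ Kk).
have ah : a ^ h = a^-1 by rewrite conjgM ah0 conjVg cak.
split.
  (* In an abelian [A] one would have a = a^-1, and d would divide 2. *)
  apply: contraL (d3) => abA; rewrite -leqNgt -oa dvdn_leq // order_dvdn.
  rewrite expgS expg1 -eq_invg_mul -ah; apply/eqP/conjg_fixP/commgP.
  exact: (centsP abA _ Aa _ Ah).
apply: (perm_isomorphic_onI (injf := injf)) => //.
have ext_rev : extend_perm injf (perm (@rev_ord_inj d)) = h.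
  apply/esym/extend_permP => [|i]; rewrite ?imf ?onA // permE /f.
  rewrite -permM conjgC conjXg ah permM /h [in LHS]permM.
  move: ek; rewrite /= apermE => <-.
  rewrite -permM expgVn -invMg -expgSr; congr ((_ : {perm V}) w).
  by apply/eqP; rewrite eq_invg_mul -expgD subnKC // -oa expg_order.
rewrite morphim_gen ?subsetT // morphimU !morphim_set1 ?inE //= ext_rot ext_rev.
apply/eqP; rewrite eqEsubset gen_subG subUset !sub1set Aa Ah /=.
apply/subsetP=> g Ag; have sa : <[a]> \subset <<[set a; h]>>.
  by rewrite cycle_subG mem_gen ?set21.
have [ag|ag] := conjK Ka Ag; first exact/(subsetP sa)/centA.
(* Both [g] and [h] invert [a], so [g * h^-1] centralises it. *)
rewrite -[g](mulgKV h) groupM ?(mem_gen (set22 _ _)) // (subsetP sa) // centA //.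
  by rewrite groupM ?groupV.
by rewrite conjgM ag -ah conjgK.
Qed.

End AbelianTransitive.
(** * Arc-transitive graphs *)

Lemma morphim_transitive (U W : finType) (S : {set U}) (L M : {group {perm W}})
    (f : W -> U) (phi : {morphism L >-> {perm U}}) :
  f @: [set: W] = S -> (forall a w, a \in L -> f (a w) = phi a (f w)) ->
  M \subset L -> [transitive M, on [set: W] | 'P] -> [transitive phi @* M, on S | 'P].
Proof.
move=> imf phiE sML trM; have [w _ _] := imsetP trM.
have Sf y : f y \in S by rewrite -imf imset_f ?inE.
apply/imsetP; exists (f w) => //; apply/eqP; rewrite eqEsubset; apply/andP; split.
  rewrite -imf; apply/subsetP=> _ /imsetP[y _ ->].
  have [a Ma ->] := atransP2 trM (in_setT w) (in_setT y).
  have La := subsetP sML a Ma; rewrite /= apermE phiE //.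
  by apply/orbitP; exists (phi a); rewrite ?mem_morphim.
apply/subsetP=> _ /orbitP[_ /morphimP[a La Ma ->] <-].
by rewrite /= apermE -phiE.
Qed.

Lemma perm_isomorphic_quasiprimitive (U W : finType) (S : {set U})
    (A : {group {perm U}}) (L : {group {perm W}}) :
  [transitive L, on [set: W] | 'P] -> quasiprimitive L ->
  perm_isomorphic_on S A L -> quasiprimitive_on A S.
Proof.
move=> trL qpL [f [phi [injf imf /isomP[injphi defA] phiE]]].
split=> [|N nNA N1].
  by rewrite -defA; apply: (morphim_transitive imf phiE).
have sNA : N \subset phi @* L by rewrite defA normal_sub.
rewrite -(morphpreK sNA); apply: (morphim_transitive imf phiE); first exact: subsetIl.
apply: qpL; last first.
  by apply: contraNneq N1 => pN; rewrite -(morphpreK sNA) pN morphim1.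
have pA : phi @*^-1 A = L by rewrite -defA injmK.
by have := morphpre_normal sNA (_ : A \subset phi @* L); rewrite pA defA => -> //.
Qed.

(** Trades the isomorphism of groups for an element-by-element matching along [f], which is easily
    moved to another vertex or to the quotient graph. *)
Lemma locally_atP (V W : finType) (e : rel V) (G : {group {perm V}})
    (L : {group {perm W}}) (v : V) : G \subset graph_aut e ->
  locally_at e G L v <->
  exists f : W -> V, [/\ injective f, f @: [set: W] = nbhd e v,
    forall g, g \in 'C_G[v | 'P] -> exists2 s, s \in L & forall w, g (f w) = f (s w)
  & forall s, s \in L -> exists2 g, g \in 'C_G[v | 'P] & forall w, g (f w) = f (s w)].
Proof.
move=> sGaut.
have nS g : g \in 'C_G[v | 'P] -> g \in 'N(nbhd e v | 'P).
  case/setIP=> /(subsetP sGaut); rewrite inE => /'forall_'forall_eqP ge /astab1P gv.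
  apply/astabsP=> w; rewrite !inE /= apermE -{1}[v]gv /= apermE ge //.
have restrE f : f @: [set: W] = nbhd e v -> forall g, g \in 'C_G[v | 'P] ->
    forall w, restr_perm (nbhd e v) g (f w) = g (f w).
  by move=> imf g Gg w; rewrite restr_permE ?nS // -imf imset_f ?inE.
split=> [[f [phi [injf imf /isomP[_ defA] phiE]]]|[f [injf imf GL LG]]].
  exists f; split=> // [g Gg|s Ls].
    have: restr_perm (nbhd e v) g \in phi @* L by rewrite defA mem_morphim ?nS.
    case/morphimP=> s _ Ls eg; exists s => // w.
    by rewrite phiE // -eg restrE.
  have: phi s \in local_group e G v by rewrite -defA mem_morphim.
  case/morphimP=> g _ Gg eg; exists g => // w.
  by rewrite phiE // eg restrE.
apply: (perm_isomorphic_onI (injf := injf)) => //; apply/setP=> a.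
apply/morphimP/morphimP=> [[s _ Ls ->]|[g Ng Gg ->]].
  have [g Gg gf] := LG s Ls; exists g; rewrite ?nS //; apply/esym/extend_permP.
    by rewrite imf restr_perm_on.
  by move=> w; rewrite restrE.
have [s Ls gf] := GL g Gg; exists s; rewrite ?inE //; apply/extend_permP.
  by rewrite imf restr_perm_on.
by move=> w; rewrite restrE.
Qed.

Section ArcTransitive.

Variables (V : finType) (e : rel V) (G : {group {perm V}}).
Hypotheses (connG : connected_simple_graph e) (sGaut : G \subset graph_aut e)
  (arcG : arc_transitive e G).

Lemma graph_autE g x y : g \in G -> e (g x) (g y) = e x y.
Proof. by move/(subsetP sGaut); rewrite inE => /forallP/(_ x)/forallP/(_ y)/eqP. Qed.

Lemma nbhd_aut g v w : g \in G -> (g w \in nbhd e (g v)) = (w \in nbhd e v).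
Proof. by move=> Gg; rewrite !inE graph_autE. Qed.

Lemma connected_ind (A : pred V) x :
  (forall u w, A u -> e u w -> A w) -> A x -> forall y, A y.
Proof.
move=> clA Ax y; have [_ _ /(_ x y)/connectP[s es ->]] := connG.
by elim: s x Ax es => //= w s IHs x Ax /andP[/(clA _ _ Ax)]; apply: IHs.
Qed.

Lemma arc_swap v w : e v w -> exists g, [/\ g \in G, g v = w & g w = v].
Proof. by have [sym_e _ _] := connG => evw; apply: arcG; rewrite // sym_e. Qed.

Lemma vertex_transitive x y : exists2 g, g \in G & g x = y.
Proof.
suff: y \in orbit 'P G x by case/orbitP=> g Gg <-; exists g.
apply: (@connected_ind [in orbit 'P G x] x) y; last exact: orbit_refl.
move=> u w xGu /arc_swap[g [Gg <- _]].
by rewrite /= -[g u]/(aperm u g) orbit_actr.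
Qed.

Lemma locally_at_all (W : finType) (L : {group {perm W}}) :
  locally e G L -> forall v, locally_at e G L v.
Proof.
case=> v0 /(locally_atP _ _ sGaut)[f [injf imf GL LG]] v.
have [g Gg <-] := vertex_transitive v0 v.
apply/(locally_atP _ _ sGaut); exists (g \o f); split.
- exact: inj_comp (@perm_inj _ g) injf.
- rewrite imset_comp imf; apply/setP=> x; apply/imsetP/idP=> [[y vy ->]|].
    by rewrite nbhd_aut.
  rewrite -{1}[x](permKV g) nbhd_aut // => vx.
  by exists (g^-1 x); rewrite ?permKV.
- move=> h /setIP[Gh /astab1P hv].
  have [|s Ls hs] := GL (h ^ g^-1).
    rewrite inE groupJ ?groupV //=; apply/astab1P.
    by rewrite conjgE invgK /= apermE !permM -[h (g v0)]/('P%act (g v0) h) hv permK.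
  by exists s => // w; rewrite /= -hs conjgE invgK !permM permKV.
move=> s Ls; have [h /setIP[Gh /astab1P hv] hs] := LG s Ls.
exists (h ^ g); last by move=> w /=; rewrite -hs conjgE !permM permK.
rewrite inE groupJ //=; apply/astab1P.
by rewrite /= apermE conjgE !permM permK -[h v0]/('P%act v0 h) hv.
Qed.

Lemma orbit_norm (N : {group {perm V}}) g v : g \in G -> N <| G ->
  orbit 'P N (g v) = g @: orbit 'P N v.
Proof.
move=> Gg /andP[_ /subsetP/(_ g Gg) nNg].
apply/setP=> x; apply/orbitP/imsetP=> [[n Nn <-]|[_ /orbitP[n Nn <-] ->]].
  exists ((n ^ g^-1) v); last by rewrite conjgE invgK !permM permKV.
  by apply/orbitP; exists (n ^ g^-1); rewrite // memJ_norm ?groupV.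
exists (n ^ g); first by rewrite memJ_norm.
by rewrite /= !apermE conjgE !permM permK.
Qed.

Lemma card_orbit_norm (N : {group {perm V}}) v x : N <| G ->
  #|orbit 'P N x| = #|orbit 'P N v|.
Proof.
move=> nNG; have [g Gg <-] := vertex_transitive v x.
by rewrite orbit_norm // card_imset //; apply: perm_inj.
Qed.

(** The orbits of [v] and [w] together are closed under adjacency, so they cover [V]; orbits of a
    normal subgroup have equal size. *)
Lemma two_orbits (N : {group {perm V}}) v w : N <| G -> e v w ->
    (forall u x y, e u x -> e u y -> y \in orbit 'P N x) ->
  #|V| = #|orbit 'P N v| \/ #|V| = (2 * #|orbit 'P N v|)%N.
Proof.
move=> nNG evw nbN; have [sym_e _ _] := connG.
have eN n x y : n \in N -> e (n x) (n y) = e x y.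
  by move=> Nn; apply: graph_autE; apply: (subsetP (normal_sub nNG)).
have cover : forall x, x \in orbit 'P N v :|: orbit 'P N w.
  apply: (@connected_ind [in orbit 'P N v :|: orbit 'P N w] v); last first.
    by rewrite /= inE orbit_refl.
  move=> u y /setUP[] /orbitP[n Nn <-] euy; apply/setUP; [right | left].
    apply: orbit_trans (mem_orbit 'P w Nn).
    by apply: nbN euy; rewrite /= !apermE eN.
  apply: orbit_trans (mem_orbit 'P v Nn).
  by apply: nbN euy; rewrite /= !apermE eN // sym_e.
have cardV : #|V| = #|orbit 'P N v :|: orbit 'P N w|.
  by rewrite -cardsT; congr #|pred_of_set _|; apply/setP=> x; rewrite cover inE.
have [vw|nvw] := boolP (w \in orbit 'P N v).
  by left; move/orbit_eqP: vw => vw; rewrite cardV vw setUid.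
right; rewrite cardV cardsU (card_orbit_norm v w nNG) disjoint_setI0 ?cards0 ?subn0 ?addnn ?mul2n //.
rewrite -setI_eq0; apply: contraNT nvw => /set0Pn[x /setIP[vx]].
by rewrite orbit_sym => /orbit_trans; apply.
Qed.

(** Conjugation carries the hypothesis from [v0] to every vertex; an element of [N] fixing one
    vertex then fixes everything by connectedness. *)
Lemma stab_fix_nbhd (N : {group {perm V}}) v0 : N <| G ->
    (forall n, n \in 'C_N[v0 | 'P] -> {in nbhd e v0, forall w, n w = w}) ->
  forall v, 'C_N[v | 'P] = 1.
Proof.
move=> nNG fix0 v; have /andP[_ /subsetP nNg] := nNG.
have fixN n u w : n \in N -> n u = u -> e u w -> n w = w.
  move=> Nn nu euw; have [g Gg gu] := vertex_transitive v0 u.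
  have := fix0 (n ^ g^-1) _ (g^-1 w).
  rewrite conjgE invgK !permM permKV => fixgw; apply: (@perm_inj _ g^-1).
  rewrite [LHS]fixgw //; last by rewrite inE -(graph_autE _ _ Gg) gu permKV.
  rewrite inE -{1}[g]invgK -conjgE memJ_norm ?groupV ?nNg ?Nn //=.
  by apply/astab1P; rewrite /= apermE !permM gu nu -gu permK.
apply/trivgP/subsetP=> n /setIP[Nn /astab1P nv]; apply/set1P/permP=> x.
rewrite perm1; apply/eqP; apply: (@connected_ind [pred y | n y == y] v) x => /=.
  by move=> u w /eqP nu /(fixN n u w Nn nu)/eqP.
by rewrite -[n v]/('P%act v n) nv.
Qed.

Lemma nbhd_actsP v : [acts 'C_G[v | 'P], on nbhd e v | 'P].
Proof.
apply/subsetP=> g /setIP[Gg /astab1P gv]; apply/astabsP=> w.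
by rewrite /= apermE -{1}[v]gv /= apermE nbhd_aut.
Qed.

Lemma restr_nbhdE v g w : g \in 'C_G[v | 'P] -> w \in nbhd e v ->
  restr_perm (nbhd e v) g w = g w.
Proof. by move=> Gg vw; rewrite restr_permE // (subsetP (nbhd_actsP v)). Qed.

Lemma restr_transitive v (N : {group {perm V}}) : N \subset 'C_G[v | 'P] ->
  [transitive restr_perm (nbhd e v) @* N, on nbhd e v | 'P] =
  [transitive N, on nbhd e v | 'P].
Proof.
move=> /subsetP sNG; rewrite /atrans.
suff -> : orbit 'P (restr_perm (nbhd e v) @* N) @: nbhd e v =
  orbit 'P N @: nbhd e v by [].
apply: eq_in_imset => w vw.
apply/setP=> x; apply/orbitP/orbitP=> [[_ /morphimP[n _ Nn ->] <-]|[n Nn <-]].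
  by exists n; rewrite //= !apermE restr_nbhdE ?sNG.
exists (restr_perm (nbhd e v) n); last by rewrite /= !apermE restr_nbhdE ?sNG.
by rewrite mem_morphim // (subsetP (nbhd_actsP v)) ?sNG.
Qed.
Hypothesis qpG : forall v, quasiprimitive_on (local_group e G v) (nbhd e v).

(** N_v induces a normal subgroup of the quasiprimitive local group. If it is intransitive at one
    vertex, it is trivial there and [stab_fix_nbhd] applies. *)
Lemma stab_transitive_or_trivial (N : {group {perm V}}) : N <| G ->
  (forall v, [transitive 'C_N[v | 'P], on nbhd e v | 'P]) \/
  (forall v, 'C_N[v | 'P] = 1).
Proof.
move=> nNG; case: (pickP (fun v => ~~ [transitive 'C_N[v | 'P], on nbhd e v | 'P])).
  move=> v nt; right; apply: (@stab_fix_nbhd N v) => // n Cn w vw.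
  have sNG : 'C_N[v | 'P] \subset 'C_G[v | 'P] by rewrite setSI ?normal_sub.
  suff: restr_perm (nbhd e v) n = 1.
    by move/permP/(_ w); rewrite restr_nbhdE ?perm1 // (subsetP sNG).
  apply/eqP; apply: contraR nt => n1; rewrite -restr_transitive //.
  apply: (qpG v).2; last first.
    apply/trivgPn; exists (restr_perm (nbhd e v) n) => //.
    by rewrite mem_morphim // (subsetP (nbhd_actsP v)) // (subsetP sNG).
  rewrite morphim_normal // /normal sNG; apply/subsetP=> g /setIP[Gg cg].
  by rewrite inE conjIg (normsP (normal_norm nNG)) // conjGid.
by move=> tr; left=> v; have /negbFE := tr v.
Qed.

(** * Graphs of order k p^alpha and their Sylow p-subgroup *)

Variables (d k c p alpha : nat) (P : {group {perm V}}).
Hypotheses (cardN : forall v, #|nbhd e v| = d) (d3 : (2 < d)%N)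
  (stab_le : forall v, #|'C_G[v | 'P]| <= c)
  (k0 : (0 < k)%N) (pr_p : prime p) (le_kc_p : (k * c <= p)%N)
  (alpha12 : alpha = 1%N \/ alpha = 2%N) (cardV : #|V| = (k * p ^ alpha)%N)
  (sylP : p.-Sylow(G) P).

Lemma transitive_local_stab v : [transitive 'C_G[v | 'P], on nbhd e v | 'P].
Proof. by rewrite -restr_transitive //; case: (qpG v). Qed.

Lemma degree_dvd_stab v : d %| #|'C_G[v | 'P]|.
Proof.
have trv := transitive_local_stab v; have /card_gt0P[w vw] : (0 < #|nbhd e v|)%N.
  by rewrite cardN (leq_trans _ d3).
by rewrite -(cardN v) -(atransP trv w vw) dvdn_orbit.
Qed.

Lemma degree_le_p v : (d <= #|'C_G[v | 'P]| <= p)%N.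
Proof.
rewrite dvdn_leq ?cardG_gt0 ?degree_dvd_stab //=.
by apply: leq_trans (leq_trans (stab_le v) (leq_pmull c k0)) _.
Qed.

Let v0_exists : exists v : V, true.
Proof.
have /card_gt0P[v _] : (0 < #|V|)%N by rewrite cardV muln_gt0 k0 expn_gt0 prime_gt0.
by exists v.
Qed.

Lemma p_gt2 : (2 < p)%N.
Proof.
have [v _] := v0_exists; have /andP[dG Gp] := degree_le_p v.
exact: leq_trans d3 (leq_trans dG Gp).
Qed.

Lemma odd_p : odd p.
Proof. by case/even_prime: pr_p => // p2; have := p_gt2; rewrite p2. Qed.

Lemma card_arc_transitive v : #|G| = (k * #|'C_G[v | 'P]| * p ^ alpha)%N.
Proof.
rewrite -(card_orbit_stab 'P G v) mulnAC -cardV -cardsT; congr (#|pred_of_set _| * _)%N.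
apply/setP=> x; rewrite inE; have [g Gg <-] := vertex_transitive v x.
exact: mem_orbit.
Qed.

(** If [g] reverses an arc from [v], then [g ^+ 2] fixes [v]. In odd order [g] would be a power of
    [g ^+ 2] and fix [v] too. *)
Lemma even_card : ~~ odd #|G|.
Proof.
apply/negP=> oG; have [v _] := v0_exists; have /card_gt0P[w] : (0 < #|nbhd e v|)%N.
  by rewrite cardN (leq_trans _ d3).
rewrite inE => evw; have [g [Gg gv gw]] := arc_swap evw.
have fix2 : g ^+ 2 \in 'C[v | 'P].
  by apply/astab1P; rewrite /= apermE expgS expg1 permM gv gw.
have gen2 : generator <[g]> (g ^+ 2).
  by rewrite generator_coprime coprimen2 (dvdn_odd (order_dvdG Gg)).
have : g \in 'C[v | 'P].
  have := cycle_id g; rewrite (eqP gen2); apply/subsetP.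
  by rewrite cycle_subG.
move/astab1P; rewrite /= apermE gv => vw.
by have [_ /(_ v)] := connG; rewrite -{2}vw evw.
Qed.

(** As k |G_v| <= k c <= p, divisibility would force k |G_v| = p, and |G| would be a power of the
    odd prime p. *)
Lemma p_ndvd_stab v : ~~ (p %| k * #|'C_G[v | 'P]|).
Proof.
apply/negP=> pk; have /andP[dG Gp] := degree_le_p v.
have leq_p : (k * #|'C_G[v | 'P]| <= p)%N.
  by apply: leq_trans le_kc_p; rewrite leq_mul2l stab_le orbT.
have eq_p : (k * #|'C_G[v | 'P]|)%N = p.
  by apply/eqP; rewrite eqn_leq leq_p dvdn_leq // muln_gt0 k0 cardG_gt0.
by have := even_card; rewrite (card_arc_transitive v) eq_p -expnS oddX odd_p orbT.
Qed.

Lemma coprime_stab v : coprime p #|'C_G[v | 'P]|.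
Proof. by rewrite prime_coprime //; apply: contra (p_ndvd_stab v) => /dvdn_mull->. Qed.

Lemma card_Sylow_arc_transitive : #|P| = (p ^ alpha)%N.
Proof.
have [v _] := v0_exists; rewrite (card_Hall sylP) (card_arc_transitive v) p_part.
rewrite logn_Gauss; last by rewrite prime_coprime ?p_ndvd_stab.
by rewrite pfactorK.
Qed.

(** The number of Sylow p-subgroups is at most |G : P| = k |G_v| <= p and is 1 modulo p, so it is
    1. *)
Lemma Sylow_normal : P <| G.
Proof.
have [v _] := v0_exists; rewrite /normal (pHall_sub sylP) /=.
have iP : #|G : P| = (k * #|'C_G[v | 'P]|)%N.
  rewrite -divgS ?(pHall_sub sylP) // card_Sylow_arc_transitive (card_arc_transitive v).
  by rewrite mulnK // expn_gt0 prime_gt0.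
have le_p : (#|'Syl_p(G)| <= p)%N.
  rewrite (card_Syl sylP); apply: leq_trans (_ : k * #|'C_G[v | 'P]| <= _)%N.
    rewrite -iP dvdn_leq // indexgS // subsetI (pHall_sub sylP) normG //.
  by apply: leq_trans le_kc_p; rewrite leq_mul2l stab_le orbT.
have := card_Syl_mod G pr_p; move: le_p; rewrite leq_eqVlt => /orP[/eqP->|ltp].
  by rewrite modnn.
rewrite modn_small // (card_Syl sylP) => /eqP; rewrite indexg_eq1.
by rewrite subsetI subxx.
Qed.

Lemma Sylow_semiregular : semiregular_perm_group P.
Proof.
move=> v; apply/trivgP; have cop : coprime #|P| #|'C_G[v | 'P]|.
  by rewrite card_Sylow_arc_transitive coprimeXl ?coprime_stab.
rewrite -(coprime_TIg cop) subsetI subsetIl setSI //; exact: pHall_sub sylP.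
Qed.

Lemma Sylow_abelian : abelian P.
Proof.
case: alpha12 card_Sylow_arc_transitive => -> cP; last exact: card_p2group_abelian cP.
by apply: cyclic_abelian; apply: prime_cyclic; rewrite cP expn1.
Qed.

(* Schur-Zassenhaus: [P] is a central Sylow subgroup of [C_G(P)], which is
   therefore [P x Q] with [Q] characteristic. *)
Lemma cent_Sylow_complement : exists2 Q : {group {perm V}}, Q <| G & coprime p #|Q| /\
  (forall H : {group {perm V}}, H \subset 'C_G(P) -> coprime p #|H| -> H \subset Q).
Proof.
pose C := 'C_G(P)%G; have nPG := Sylow_normal.
have sPC : P \subset C by rewrite subsetI (pHall_sub sylP); apply: Sylow_abelian.
have sCG : C \subset G := subsetIl _ _.
have sylPC : p.-Sylow(C) P := pHall_subl sPC sCG sylP.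
have nPC : P <| C := normalS sPC sCG nPG.
have /splitsP[Q /complP[tiPQ defC]] := SchurZassenhaus_split (pHall_Hall sylPC) nPC.
have sQC : Q \subset C by rewrite -defC mulG_subr.
have p'Q : coprime p #|Q|.
  have [_ _] := and3P sylPC; rewrite -divgS // -[#|C|]/#|gval C| -defC TI_cardMg // mulKn //.
  by rewrite p'natE // prime_coprime.
have nQC : Q <| C.
  rewrite /normal sQC -{1}defC mul_subG ?normG //.
  by apply: subset_trans (cent_sub Q); rewrite centsC (subset_trans sQC) ?subsetIr.
have hallQ : p^'.-Hall(C) Q.
  apply/and3P; split=> //; first by rewrite /pgroup p'natE // -prime_coprime.
  rewrite -divgS // -[#|C|]/#|gval C| -defC TI_cardMg // mulnK // pnatNK.
  exact: pHall_pgroup sylP.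
exists Q.
  rewrite -(normal_Hall_pcore hallQ nQC); apply: char_normal_trans (pcore_char _ _) _.
  by rewrite /normal subsetIl normsI ?normG ?norms_cent ?normal_norm.
split=> // H sHC p'H.
by rewrite (sub_normal_Hall hallQ nQC) // /pgroup p'natE // -prime_coprime.
Qed.

(* A p'-group cannot have at most two orbits on a set whose size is divisible by [p]. *)
Lemma stab_cent_Sylow v : 'C_G[v | 'P] :&: 'C(P) = 1.
Proof.
have [Q nQG [p'Q maxQ]] := cent_Sylow_complement.
have [trQ|trivQ] := stab_transitive_or_trivial nQG; last first.
  apply/trivgP; rewrite -(trivQ v) subsetI; apply/andP; split; last first.
    by rewrite subIset // subsetIr.
  apply: maxQ; first by rewrite setSI ?subsetIl.
  exact: coprime_dvdr (cardSg (subsetIl _ _)) (coprime_stab v).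
have p'orb : coprime p #|orbit 'P Q v| by apply: coprime_dvdr (dvdn_orbit _ _ _) p'Q.
have pV : p %| #|V|.
  by rewrite cardV dvdn_mull // dvdn_exp //; case: alpha12 => ->.
have /card_gt0P[w vw] : (0 < #|nbhd e v|)%N by rewrite cardN (leq_trans _ d3).
move: vw; rewrite inE => evw.
have [u x y ux uy|oV|oV] := two_orbits nQG evw.
- have := atransP (trQ u) x; rewrite inE => /(_ ux)/setP/(_ y).
  by rewrite !inE uy => /orbitP[g /setIP[Qg _] <-]; apply: mem_orbit.
- by move: pV; rewrite oV; have := p'orb; rewrite prime_coprime // => /negPf->.
by move: pV; rewrite oV Gauss_dvdl // => /(dvdn_leq (ltn0Sn 1)); rewrite leqNgt p_gt2 //.
Qed.

Lemma stab_norm_Sylow v : 'C_G[v | 'P] \subset 'N(P).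
Proof. by rewrite subIset // normal_norm ?Sylow_normal. Qed.

Lemma injm_stab_conj_aut v :
  'injm (restrm_morphism (stab_norm_Sylow v) (conj_aut_morphism P)).
Proof. by rewrite ker_restrm ker_conj_aut stab_cent_Sylow. Qed.

Lemma stab_isog_Aut_Sylow v : exists H : {group {perm {perm V}}},
  H \subset Aut P /\ 'C_G[v | 'P] \isog H.
Proof.
exists (conj_aut P @* 'C_G[v | 'P])%G; split; first exact: Aut_conj_aut.
apply/isogP; exists (restrm_morphism (stab_norm_Sylow v) (conj_aut_morphism P)).
  exact: injm_stab_conj_aut.
by rewrite morphim_restrm setIid.
Qed.

(** The hypotheses on [K] survive restriction to the neighbourhood. Recording that G_v is
    non-abelian in the dihedral case lets [local_cyclic] discard it. *)
Lemma local_cyclic_or_dihedral v (K : {group {perm V}}) :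
    K \subset 'C_G[v | 'P] -> abelian K -> [transitive K, on nbhd e v | 'P] ->
    {in K & 'C_G[v | 'P], forall a g, a ^ g = a \/ a ^ g = a^-1} ->
  prime d /\ (locally_at e G (cyclic_perm_group d) v \/
              ~~ abelian 'C_G[v | 'P] /\ locally_at e G (dihedral_perm_group d) v).
Proof.
move=> sKG abK trK conjK; set r := restr_perm (nbhd e v).
have nK := subset_trans sKG (nbhd_actsP v).
have onA : {in local_group e G v, forall a, perm_on (nbhd e v) a}.
  by move=> _ /morphimP[g _ _ ->]; apply: restr_perm_on.
have sKA : r @* K \subset local_group e G v by apply: morphimS.
have abrK : abelian (r @* K) by apply: morphim_abelian.
have trrK : [transitive r @* K, on nbhd e v | 'P] by rewrite restr_transitive.
have conjrK : {in r @* K & local_group e G v, forall a g, a ^ g = a \/ a ^ g = a^-1}.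
  move=> _ _ /morphimP[a Na Ka ->] /morphimP[g Ng Gg ->].
  by rewrite -morphJ // -morphV //; case: (conjK a g Ka Gg) => ->; [left|right].
split; first exact: prime_abelian_transitive (cardN v) d3 onA (qpG v) sKA abrK trrK conjrK.
have [|[nab]] := cyclic_or_dihedral (cardN v) d3 onA (qpG v) sKA abrK trrK conjrK.
  by left.
by right; split=> //; apply: contra nab; apply: morphim_abelian.
Qed.

Lemma local_cyclic v : abelian 'C_G[v | 'P] ->
  prime d /\ locally_at e G (cyclic_perm_group d) v.
Proof.
move=> abG; have conjG : {in 'C_G[v | 'P] &, forall a g, a ^ g = a \/ a ^ g = a^-1}.
  move=> a g Ga Gg; left; apply/conjg_fixP/commgP.
  exact: (centsP abG _ Ga _ Gg).
have [] := local_cyclic_or_dihedral (subxx _) abG (transitive_local_stab v) conjG.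
by move=> prd [|[]]; rewrite ?abG.
Qed.

(** * Abelian vertex stabilisers *)

Section AbelianStabiliser.

Hypothesis abG : forall v, abelian 'C_G[v | 'P].

(** An element of the abelian group G_v fixing one neighbour of v fixes them all. The induction runs
    over vertices fixed together with their neighbourhoods. *)
Lemma abelian_stab_arc v w g : e v w -> g \in G -> g v = v -> g w = w -> g = 1.
Proof.
have [sym_e _ _] := connG => evw Gg gv gw.
have fixN u x y : e u x -> e u y -> g u = u -> g x = x -> g y = y.
  move=> ux uy gu gx; have Sg : g \in 'C_G[u | 'P].
    by rewrite inE Gg; apply/astab1P.
  have [||h Sh ->] := atransP2 (transitive_local_stab u) (_ : x \in _) (_ : y \in _).
  - by rewrite inE.
  - by rewrite inE.
  by rewrite /= apermE -permM -(centsP (abG u) _ Sg _ Sh) permM gx.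
apply/permP=> x; rewrite perm1.
pose A := [pred u | (g u == u) && [forall y, e u y ==> (g y == y)]].
suff: A x by case/andP=> /eqP.
apply: (@connected_ind A v) => [u y /andP[/eqP gu /forallP fixu] uy|]; last first.
  rewrite /= gv eqxx; apply/forallP=> y; apply/implyP=> vy; apply/eqP.
  exact: fixN evw vy gv gw.
have gy : g y = y by apply/eqP; have /implyP := fixu y; apply.
rewrite /= gy eqxx; apply/forallP=> z; apply/implyP=> yz; apply/eqP.
by apply: fixN yz gy gu; rewrite sym_e.
Qed.

Lemma card_abelian_stab v : #|'C_G[v | 'P]| = d.
Proof.
have /card_gt0P[w vw] : (0 < #|nbhd e v|)%N by rewrite cardN (leq_trans _ d3).
rewrite -(card_orbit_stab 'P _ w) (atransP (transitive_local_stab v)) // cardN.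
rewrite (_ : 'C_('C_G[v | 'P])[w | 'P] = 1) ?cards1 ?muln1 //.
apply/trivgP/subsetP=> g /setIP[/setIP[Gg /astab1P gv] /astab1P gw]; apply/set1P.
by apply: (@abelian_stab_arc v w); rewrite // inE in vw.
Qed.

End AbelianStabiliser.

(** The generated subgroup contains G_v, so it suffices that it is transitive on vertices, which
    follows by walking along edges. *)
Lemma gen_stab_swap v w t : e v w -> t \in G -> t v = w ->
  <<t |: 'C_G[v | 'P]>> = G.
Proof.
move=> evw Gt tv; set H := <<_>>.
have sHG : H \subset G by rewrite gen_subG subUset sub1set Gt subsetIl.
have sSH : 'C_G[v | 'P] \subset H by apply: subset_trans (subsetUr _ _) (subset_gen _).
have Ht : t \in H by rewrite mem_gen ?setU11.
have trH x : x \in orbit 'P H v.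
  apply: (@connected_ind [in orbit 'P H v] v) x; last exact: orbit_refl.
  move=> _ y /orbitP[h Hh <-] /= ehy; have Gh := subsetP sHG h Hh.
  have vy : h^-1 y \in nbhd e v.
    by rewrite inE -(graph_autE _ _ Gh) permKV.
  have vw : w \in nbhd e v by rewrite inE.
  have [s Ss ys] := atransP2 (transitive_local_stab v) vw vy.
  (* Products act from left to right: v goes to w, then to [h^-1 y], then to y. *)
  apply/orbitP; exists (t * s * h); first by rewrite !groupM // (subsetP sSH).
  by rewrite /= apermE !permM tv -[s w]/('P%act w s) -ys permKV.
apply/eqP; rewrite eqEsubset sHG; apply/subsetP=> g Gg.
have /orbitP[h Hh hv] := trH (g v).
have Ggh : g * h^-1 \in G by rewrite groupM ?groupV // (subsetP sHG).
rewrite -[g](mulgKV h) groupM // (subsetP sSH) // inE Ggh.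
by apply/astab1P; rewrite /= apermE permM -hv /= apermE permK.
Qed.

Lemma degree_ndvd_p : prime d -> coprime d p.
Proof.
move=> prd; have [v _] := v0_exists.
by rewrite coprime_sym; apply: coprime_dvdr (degree_dvd_stab v) (coprime_stab v).
Qed.

Lemma card_quotient_Sylow v : #|G / P| = (k * #|'C_G[v | 'P]|)%N.
Proof.
rewrite card_quotient ?normal_norm ?Sylow_normal // -divgS ?(pHall_sub sylP) //.
by rewrite card_Sylow_arc_transitive (card_arc_transitive v) mulnK // expn_gt0 prime_gt0.
Qed.

(** * Cyclic Sylow subgroup *)

Section CyclicSylow.

Hypothesis cycP : cyclic P.

Let abG v : abelian 'C_G[v | 'P].
Proof.
rewrite -(injm_abelian (injm_stab_conj_aut v)) // morphim_restrm.
by apply: abelianS (Aut_cyclic_abelian cycP); apply: Aut_conj_aut.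
Qed.

(** G acts on P through the abelian group Aut(P). *)
Lemma der_sub_cent_cyclic : [~: G, G] \subset 'C_G(P).
Proof.
have nPG : G \subset 'N(P) by rewrite normal_norm ?Sylow_normal.
rewrite subsetI commg_subl normG /= -ker_conj_aut gen_subG.
apply/subsetP=> _ /imset2P[x y Gx Gy ->].
have [Nx Ny] := (subsetP nPG x Gx, subsetP nPG y Gy).
apply/kerP; rewrite ?groupR // morphR //; apply/eqP/commgP.
have AutP z : z \in 'N(P) -> conj_aut P z \in Aut P.
  by move=> Nz; apply: (subsetP (Aut_conj_aut P 'N(P))); apply: mem_morphim.
by apply: (centsP (Aut_cyclic_abelian cycP)); apply: AutP.
Qed.

(** Keeps the image of [t] non-trivial in the abelianisation of G / P, whence the factor 2 in the
    order 2d. *)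
Lemma swap_notin_cent_Sylow v w t : e v w -> t \in G -> t v = w -> t ^+ 2 = 1 ->
  t \notin 'C_G(P).
Proof.
move=> evw Gt tv t2; apply/negP=> Ct.
have [Q nQG [p'Q maxQ]] := cent_Sylow_complement.
have Qt : t \in Q.
  rewrite -cycle_subG; apply: maxQ; first by rewrite cycle_subG.
  rewrite coprime_sym; apply: (@coprime_dvdl _ 2).
    by rewrite -orderE order_dvdn t2.
  by rewrite prime_coprime // dvdn2 odd_p.
have sGQ : G \subset Q <*> 'C_G[v | 'P].
  rewrite -{1}(gen_stab_swap evw Gt tv) gen_subG subUset joing_subr sub1set andbT.
  by apply: subsetP Qt; apply: joing_subl.
have : coprime p #|Q <*> 'C_G[v | 'P]|.
  rewrite norm_joinEr; last by rewrite subIset // normal_norm.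
  apply: coprime_dvdr (_ : #|_| %| #|Q| * #|'C_G[v | 'P]|)%N _.
    by rewrite mul_cardG dvdn_mulr.
  by rewrite coprimeMr p'Q coprime_stab.
rewrite prime_coprime //; apply/negP; rewrite negbK.
apply: dvdn_trans (cardSg sGQ); apply: dvdn_trans (cardSg (pHall_sub sylP)).
by rewrite card_Sylow_arc_transitive dvdn_exp //; case: alpha12 => ->.
Qed.

Lemma cyclic_Sylow_case :
  [/\ prime d, p = 1 %[mod (2 * d)%N],
      forall v, locally_at e G (cyclic_perm_group d) v,
      #|G / P| = (k * d)%N
    & (G / P) / [~: G / P, G / P] \isog Zp (2 * d)%N].
Proof.
have [v _] := v0_exists; have [prd _] := local_cyclic (abG v).
have od := card_abelian_stab abG v.
have co2d : coprime 2 d.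
  by rewrite prime_coprime // dvdn_prime2 //; case: d d3 => [|[|[|?]]].
split=> // [|u||]; last 2 first.
- by rewrite (card_quotient_Sylow v) od.
- have /card_gt0P[w] : (0 < #|nbhd e v|)%N by rewrite cardN (leq_trans _ d3).
  rewrite inE => evw; have [t [Gt tv tw]] := arc_swap evw.
  have t2 : t ^+ 2 = 1.
    by apply: (abelian_stab_arc abG evw); rewrite ?groupX // expgS expg1 permM ?tv ?tw.
  have nCt := swap_notin_cent_Sylow evw Gt tv t2.
  have [x Sx x1] : exists2 x, x \in 'C_G[v | 'P] & x != 1.
    by apply/trivgPn; rewrite -cardG_gt1 od prime_gt1.
  have Gx : x \in G by case/setIP: Sx.
  have ox : #[x] = d.
    by apply/(prime_nt_dvdP prd); rewrite ?order_eq1 // -od order_dvdG.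
  have defS : 'C_G[v | 'P] = <[x]>.
    by apply/eqP; rewrite eq_sym eqEcard cycle_subG Sx od -orderE ox /=.
  have nCx : x \notin 'C_G(P).
    apply: contra x1 => /setIP[_ cPx].
    have : x \in 'C_G[v | 'P] :&: 'C(P) by rewrite in_setI Sx.
    by rewrite stab_cent_Sylow => /set1P->.
  have nPG : G \subset 'N(P) by rewrite normal_norm ?Sylow_normal.
  set D := G / P; set D' := [~: D, D]; have nD : D \subset 'N(D') := der_norm 1 D.
  pose q y := coset D' (coset P y).
  have Dq y : y \in G -> coset P y \in D by apply: mem_quotient.
  have qM y z : y \in G -> z \in G -> q (y * z) = q y * q z.
    by move=> Gy Gz; rewrite /q !morphM ?(subsetP nPG) ?(subsetP nD) ?Dq.
  have qX y n : y \in G -> q (y ^+ n) = q y ^+ n.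
    by move=> Gy; rewrite /q !morphX ?(subsetP nPG) ?(subsetP nD) ?Dq.
  (* The kernel of [q] is [G, G] P, which lies in C_G(P), so [t] and [x] keep their orders 2 and d
     under [q]. *)
  have q1 y : y \in G -> q y = 1 -> y \in 'C_G(P).
    move=> Gy /coset_idr; rewrite (subsetP nD) ?Dq // => /(_ isT).
    rewrite /D' /D /= -quotientR // => /morphimP[z Nz Rz] /rcoset_kercosetP.
    rewrite (subsetP nPG) // => /(_ isT Nz) /rcosetP[u Pu ->].
    rewrite groupM //; last by apply: (subsetP der_sub_cent_cyclic).
    by rewrite inE (subsetP (pHall_sub sylP)) //= (subsetP Sylow_abelian).
  have oqx : #[q x] = d.
    apply/(prime_nt_dvdP prd).
      by rewrite order_eq1; apply: contra nCx => /eqP/(q1 x Gx).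
    by rewrite order_dvdn -qX // -ox expg_order /q !morph1.
  have oqt : #[q t] = 2.
    apply/(prime_nt_dvdP (isT : prime 2)).
      by rewrite order_eq1; apply: contra nCt => /eqP/(q1 t Gt).
    by rewrite order_dvdn -qX // t2 /q !morph1.
  have abD : abelian (D / D') := der_abelian 0 D.
  have Dqq y : y \in G -> q y \in D / D' by move=> Gy; rewrite mem_quotient ?Dq.
  have cqxt : commute (q t) (q x) by apply: (centsP abD); apply: Dqq.
  have oz : #[q t * q x] = (2 * d)%N by rewrite orderM ?oqt ?oqx.
  suff -> : D / D' = <[q t * q x]> by rewrite isog_sym -oz Zp_isog.
  apply/eqP; rewrite eq_sym eqEcard cycle_subG groupM ?Dqq // -orderE oz.
  (* G is generated by [t] and [x], so its abelian quotient is the product of two cyclic groups of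
     orders 2 and d. *)
  apply: leq_trans (_ : #|<[q t]> * <[q x]>| <= _).
    apply: subset_leq_card; rewrite -norm_joinEl; last first.
      by rewrite cents_norm // cent_cycle cycle_subG; apply/cent1P.
    rewrite sub_quotient_pre // sub_quotient_pre // -{1}(gen_stab_swap evw Gt tv) defS.
    rewrite gen_subG subUset sub1set cycle_subG.
    by rewrite !mem_morphpre ?(subsetP nPG) ?(subsetP nD) ?Dq //= mem_gen // inE cycle_id ?orbT.
  by rewrite -oqt -oqx !orderE mul_cardG leq_pmulr.
(* 2 divides p - 1 because p is odd; d = |G_v| divides |Aut(P)| = (p - 1) p^(alpha - 1) and is prime
   to p. *)
- apply/eqP; rewrite eqn_mod_dvd ?prime_gt0 // Gauss_dvd //; apply/andP; split.
    by rewrite dvdn2 oddB ?prime_gt0 // odd_p.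
  have [H [sHA /card_isog oH]] := stab_isog_Aut_Sylow v.
  have := cardSg sHA; rewrite -oH od (card_Aut_cyclic cycP) card_Sylow_arc_transitive.
  rewrite totient_pfactor //; last by case: alpha12 => ->.
  by rewrite Gauss_dvdl ?subn1 // coprimeXr ?degree_ndvd_p.
- by have [] := local_cyclic (abG u).
Qed.

End CyclicSylow.

(** * Elementary abelian Sylow subgroup of rank 2 *)

Section AbelemSylow.

Hypothesis ncycP : ~~ cyclic P.

Lemma noncyclic_alpha2 : alpha = 2%N.
Proof.
case: alpha12 card_Sylow_arc_transitive => [->|//]; rewrite expn1 => cP.
by case/negP: ncycP; apply: prime_cyclic; rewrite cP.
Qed.

Lemma noncyclic_card : #|P| = (p ^ 2)%N.
Proof. by rewrite card_Sylow_arc_transitive noncyclic_alpha2. Qed.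

Lemma noncyclic_abelem : p.-abelem P.
Proof.
rewrite abelemE // Sylow_abelian; apply/exponentP=> x Px; apply/eqP.
rewrite -order_dvdn; have : #[x] %| p ^ 2 by rewrite -noncyclic_card order_dvdG.
case/(dvdn_pfactor _ _ pr_p) => [[|[|[|//]]] _ ox]; rewrite ox ?dvd1n ?expn1 ?dvdnn //.
case/negP: ncycP; apply/cyclicP; exists x; apply/eqP.
by rewrite eq_sym eqEcard cycle_subG Px noncyclic_card -ox /=.
Qed.

(** Conjugation on P viewed as a plane over the prime field; by [stab_cent_Sylow] its kernel meets
    G_v trivially. *)
Lemma conj_repr2 : exists rG : mx_representation 'F_p G 2, rker rG = 'C_G(P).
Proof.
have nPG : G \subset 'N(P) by rewrite normal_norm ?Sylow_normal.
have ntP : P :!=: 1 by apply: contraNneq ncycP => ->; apply: cyclic1.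
have dimP : 'dim P = 2.
  by rewrite (dim_abelemE noncyclic_abelem ntP) noncyclic_card pfactorK.
have := rker_abelem noncyclic_abelem ntP nPG.
(* The representation is generalised together with its kernel so that its degree can be rewritten to
   2. *)
move: (abelem_repr noncyclic_abelem ntP nPG); rewrite dimP => rG kerG.
by exists rG.
Qed.

(* The abelian transitive subgroup [K] of [G_v] consists of the scalars, of the
   elements of determinant 1, or is [G_v] itself. *)
Lemma noncyclic_Sylow_case v :
  prime d /\ (locally_at e G (cyclic_perm_group d) v \/
              locally_at e G (dihedral_perm_group d) v).
Proof.
suff : exists K : {group {perm V}}, [/\ K \subset 'C_G[v | 'P], abelian K,
    [transitive K, on nbhd e v | 'P] &
    {in K & 'C_G[v | 'P], forall a g, a ^ g = a \/ a ^ g = a^-1}].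
  case=> K [sKG abK trK conjK].
  have [prd [|[_]]] := local_cyclic_or_dihedral sKG abK trK conjK; first by split; [|left].
  by split; [|right].
have [rG kerG] := conj_repr2.
have sSG : 'C_G[v | 'P] \subset G := subsetIl _ _.
have sG x : x \in 'C_G[v | 'P] -> x \in G by apply: (subsetP sSG).
have faith x : x \in 'C_G[v | 'P] -> rG x = 1%:M%R -> x = 1.
  move=> Sx rx; have : x \in 'C_G[v | 'P] :&: 'C(P).
    rewrite in_setI Sx; have : x \in rker rG by rewrite inE sG // mul1mx rx eqxx.
    by rewrite kerG => /setIP[].
  by rewrite stab_cent_Sylow => /set1P.
have commK (K : {group {perm V}}) : K \subset 'C_G[v | 'P] ->
    (forall x y, x \in K -> y \in 'C_G[v | 'P] -> [~ x, y] = 1) ->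
    abelian K /\ {in K & 'C_G[v | 'P], forall a g, a ^ g = a \/ a ^ g = a^-1}.
  move=> sKS cK; split.
    apply/centsP=> x Kx y Ky; apply/commgP; rewrite cK //.
    exact: (subsetP sKS).
  by move=> x y Kx Sy; left; apply/conjg_fixP/eqP; rewrite cK.
have [trZ|trivZ] := stab_transitive_or_trivial (rcenter_normal rG).
  exists 'C_(rcenter rG)[v | 'P]%G; have sZS : 'C_(rcenter rG)[v | 'P] \subset 'C_G[v | 'P].
    by rewrite setSI // normal_sub // rcenter_normal.
  have [|abZ conjZ] := commK _ sZS; last by split=> //; apply: trZ.
  move=> x y /setIP[/setIdP[Gx /is_scalar_mxP[a rx]] /astab1P xv] Sy.
  have Sx : x \in 'C_G[v | 'P] by rewrite inE Gx; apply/astab1P.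
  apply/faith; first by rewrite groupR.
  have Gy := sG y Sy; rewrite commgEl repr_mxM ?groupV ?groupJ //.
  suff -> : rG (x ^ y) = rG x by rewrite -repr_mxM ?groupV // mulVg repr_mx1.
  rewrite conjgE !repr_mxM ?groupM ?groupV // rx -scalar_mxC mulmxA.
  by rewrite -repr_mxM ?groupV // mulVg repr_mx1 mul1mx.
have nscal x : x \in 'C_G[v | 'P] -> is_scalar_mx (rG x) -> x = 1.
  case/setIP=> Gx cx sx; have : x \in 'C_(rcenter rG)[v | 'P] by rewrite in_setI inE Gx sx.
  by rewrite trivZ => /set1P.
have Fp_neq0 m : coprime p m -> (m%:R != 0 :> 'F_p)%R.
  by rewrite prime_coprime // (dvdn_pcharf (pchar_Fp pr_p)).
have n2 : (2%:R != 0 :> 'F_p)%R.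
  by apply: Fp_neq0; rewrite coprime_sym prime_coprime // dvdn2 odd_p.
have nS : (#|'C_G[v | 'P]|%:R != 0 :> 'F_p)%R by apply: Fp_neq0; apply: coprime_stab.
have [trK|trivK] := stab_transitive_or_trivial (det1_normal rG).
  pose K := 'C_(det1_set rG)[v | 'P]%G.
  have sKS : K \subset 'C_G[v | 'P] by rewrite setSI // normal_sub // det1_normal.
  have abK : abelian K.
    apply: (no_scalars_det1_abelian sSG n2 nS nscal sKS).
    by move=> x /setIP[/setIdP[_ /eqP]].
  exists K; split=> // [|a g Ka Sg]; first exact: trK.
  have [->|a1] := eqVneq a 1; first by left; rewrite conj1g.
  have Sa := subsetP sKS a Ka; apply: (no_scalars_conj sSG n2 nS nscal) => //.
  (* Normality puts [a ^ g] in the abelian group [K], hence in the centraliser of [a]. *)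
  have nKS : 'C_G[v | 'P] \subset 'N(K).
    rewrite normsI ?normG //; last by rewrite subIset // normG orbT.
    by rewrite subIset // normal_norm // det1_normal.
  have Kag : a ^ g \in K by rewrite memJ_norm // (subsetP nKS).
  by apply/cent1P; apply: (centsP abK).
(* Commutators have determinant 1, so they are trivial here and G_v is abelian. *)
exists 'C_G[v | 'P]%G; have [|abS conjS] := commK _ (subxx _).
  move=> x y Sx Sy; have : [~ x, y] \in 'C_(det1_set rG)[v | 'P].
    have := groupR Sx Sy; rewrite !inE => /andP[-> ->]; rewrite andbT /=.
    rewrite commgEl repr_mxM ?groupV ?groupJ ?sG // det_mulmx det_reprJ ?sG //.
    by rewrite -det_mulmx -repr_mxM ?groupV ?sG // mulVg repr_mx1 det1.
  by rewrite trivK => /set1P.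
by split=> //; apply: transitive_local_stab.
Qed.

End AbelemSylow.

(** * The quotient graph *)

Section QuotientGraph.

Hypotheses (prd : prime d) (k3 : (2 < k)%N).

Local Notation pi := (@to_orbit V P).
Local Notation Q := (quotient_graph e P).

Lemma to_orbit_eq x y : (pi x == pi y) = (x \in orbit 'P P y).
Proof. by rewrite -val_eqE /= orbit_eq_mem. Qed.

Lemma to_orbitP B : exists x, B = pi x.
Proof. by have /imsetP[x _ defB] := valP B; exists x; apply: val_inj. Qed.

Lemma card_orbit_Sylow x : #|orbit 'P P x| = (p ^ alpha)%N.
Proof.
by rewrite card_orbit Sylow_semiregular indexg1 card_Sylow_arc_transitive.
Qed.

Lemma card_orbits_Sylow : #|orbits P| = k.
Proof.
have pa0 : (0 < p ^ alpha)%N by rewrite expn_gt0 prime_gt0.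
apply/eqP; rewrite card_sig -(eqn_pmul2r pa0) -cardV -cardsT.
rewrite [X in _ == X](@card_uniform_partition _ (p ^ alpha) (orbit 'P P @: setT)) //.
  by move=> _ /imsetP[x _ ->]; apply: card_orbit_Sylow.
by apply: orbit_partition; apply/subsetP=> g _; apply/astabsP=> x; rewrite !inE.
Qed.

Lemma to_orbit_act g x y : g \in G -> (pi (g x) == pi (g y)) = (pi x == pi y).
Proof.
move=> Gg; rewrite !to_orbit_eq orbit_norm ?Sylow_normal //.
by rewrite mem_imset //; apply: perm_inj.
Qed.

(** Otherwise [two_orbits] leaves at most two orbits of size p^alpha, contrary to k >= 3. *)
Lemma nbhd_not_one_orbit v w : e v w -> exists2 y, e v y & pi y != pi w.
Proof.
move=> evw; apply/exists_inP; rewrite -[X in is_true X]negbK negb_exists_in.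
apply/negP=> /forall_inP one.
have [|oV|oV] := two_orbits Sylow_normal evw.
- have onev x y : e v x -> e v y -> pi x = pi y.
    by move=> vx vy; have /negPn/eqP-> := one x vx; have /negPn/eqP-> := one y vy.
  move=> u x y; have [g Gg <-] := vertex_transitive v u.
  rewrite -[x](permKV g) -[y](permKV g) !graph_autE // => vx vy.
  by rewrite -to_orbit_eq to_orbit_act //; apply/eqP; apply: onev.
- have := cardV; rewrite oV card_orbit_Sylow -{1}[(p ^ _)%N]mul1n => /eqP.
  rewrite eqn_pmul2r ?expn_gt0 ?prime_gt0 // => /eqP k1.
  by have := k3; rewrite -k1.
have := cardV; rewrite oV card_orbit_Sylow => /eqP.
rewrite eqn_pmul2r ?expn_gt0 ?prime_gt0 // => /eqP k2.
by have := k3; rewrite -k2.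
Qed.

(* [H] lies between [G_vw] and [G_v], and [G_vw] has prime index in [G_v]. *)
Lemma to_orbit_nbhd_inj v : {in nbhd e v &, injective pi}.
Proof.
move=> x w; rewrite !inE => evx evw /eqP exw.
pose H := ('C_G[v | 'P] :&: 'N(orbit 'P P w | 'P))%G.
have sHS : H \subset 'C_G[v | 'P] by apply: subsetIl.
have memH g : g \in 'C_G[v | 'P] -> (g \in H) = (pi (g w) == pi w).
  move=> Sg; have Gg : g \in G by case/setIP: Sg.
  rewrite in_setI Sg /=; apply/idP/eqP=> [/astabsP nHg|eg].
    by apply/eqP; rewrite to_orbit_eq -[g w]/('P%act w g) nHg orbit_refl.
  by apply/astabsP=> y; rewrite /= apermE -!to_orbit_eq -{1}eg to_orbit_act.
have sKH : 'C_('C_G[v | 'P])[w | 'P] \subset H.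
  apply/subsetP=> g /setIP[Sg /astab1P]; rewrite /= apermE => gw.
  by rewrite memH // gw eqxx.
have vw : w \in nbhd e v by rewrite inE.
have idx : #|'C_G[v | 'P] : 'C_('C_G[v | 'P])[w | 'P]| = d.
  by rewrite -card_orbit (atransP (transitive_local_stab v)).
have := Lagrange_index sHS sKH; rewrite idx => defd.
(* If H = G_vw, an element of G_v taking w to x lies in H and so fixes w. If H = G_v, all neighbours
   of v lie in one orbit. *)
have [iS|iS] : #|'C_G[v | 'P] : H| = d \/ #|'C_G[v | 'P] : H| = 1%N.
- have := primeP prd; case=> _ /(_ #|'C_G[v | 'P] : H|).
  by rewrite -{1}defd dvdn_mulr // => /(_ isT)/orP[]/eqP ->; [right|left].
- have iK : #|H : 'C_('C_G[v | 'P])[w | 'P]| = 1%N.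
    by apply/eqP; rewrite -(eqn_pmul2l (prime_gt0 prd)) -{1}iS defd muln1.
  have vx : x \in nbhd e v by rewrite inE.
  have [g Sg xg] := atransP2 (transitive_local_stab v) vw vx.
  have : g \in H by rewrite memH // -[g w]/('P%act w g) -xg.
  move/eqP: iK; rewrite indexg_eq1 => /subsetP sHK /sHK/setIP[_ /astab1P gw].
  by rewrite xg gw.
have [y vy] := nbhd_not_one_orbit evw.
have [|g Sg ->] := atransP2 (transitive_local_stab v) vw (_ : y \in _); first by rewrite inE.
rewrite -memH //; move/eqP: iS; rewrite indexg_eq1 => /subsetP/(_ g Sg)->.
by [].
Qed.

(** Otherwise arc-transitivity would put every neighbour of x in the orbit of x. *)
Lemma adjacent_to_orbit x y : e x y -> pi x != pi y.
Proof.
move=> exy; apply/eqP=> pxy; have [z exz] := nbhd_not_one_orbit exy.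
have [g [Gg gx gy]] := arcG exy exz; rewrite -pxy eq_sym -gy -{1}gx to_orbit_act //.
by rewrite pxy eqxx.
Qed.

(** An edge between two orbits can be moved by P to start at the chosen representative [x]. *)
Lemma quotient_graphP x y : reflect (exists2 z, pi z = pi y & e x z) (Q (pi x) (pi y)).
Proof.
apply: (iffP andP) => [[_ /exists_inP[_ /orbitP[g Pg <-] /exists_inP[z yz exz]]]|].
  have Gg := subsetP (pHall_sub sylP) g Pg.
  exists (g^-1 z); last by rewrite -(graph_autE _ _ Gg) permKV.
  apply/eqP; rewrite to_orbit_eq -[g^-1 z]/('P%act z g^-1) orbit_actr ?groupV //.
case=> z pz exz; split; first by rewrite -pz adjacent_to_orbit.
apply/exists_inP; exists x; first exact: orbit_refl.
by apply/exists_inP; exists z => //; rewrite -to_orbit_eq pz.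
Qed.

Lemma connected_quotient : connected_simple_graph Q.
Proof.
have [sym_e _ _] := connG; split.
- suff sym x y : Q (pi x) (pi y) -> Q (pi y) (pi x).
    move=> B C; have [x ->] := to_orbitP B; have [y ->] := to_orbitP C.
    by apply/idP/idP; apply: sym.
  case/quotient_graphP=> z pz exz; rewrite -pz; apply/quotient_graphP.
  by exists x; rewrite // sym_e.
- by move=> B; rewrite /quotient_graph /= eqxx.
move=> B C; have [x ->] := to_orbitP B; have [y ->] := to_orbitP C.
apply: (@connected_ind [pred z | connect Q (pi x) (pi z)] x) y => //= u z xu euz.
by apply: connect_trans xu (connect1 _); apply/quotient_graphP; exists z.
Qed.

Lemma regular_covering : regular_covering_projection e P.
Proof.
move=> v; split; first exact: to_orbit_nbhd_inj.
apply/setP=> B; rewrite inE; apply/imsetP/idP=> [[w]|].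
  by rewrite inE => evw ->; apply/quotient_graphP; exists w.
have [y ->] := to_orbitP B => /quotient_graphP[z pz evz].
by exists z; rewrite ?inE.
Qed.

(** The implication under the sigma type makes [orbit_perm] total, with a harmless value outside
    G. *)
Lemma orbit_perm_subproof (g : {perm V}) :
  {s : {perm orbits P} | g \in G -> forall x, s (pi x) = pi (g x)}.
Proof.
have [Gg|nGg] := boolP (g \in G); last by exists 1.
(* The default of [insubd] is never taken: P is normal, so g maps orbits to orbits. *)
pose h (B : orbits P) := insubd B (g @: val B).
have hE y : h (pi y) = pi (g y).
  apply: val_inj; rewrite /= val_insubd /= -orbit_norm ?Sylow_normal //.
  by rewrite imset_f ?inE.
have injh : injective h.
  move=> B C; have [y ->] := to_orbitP B; have [z ->] := to_orbitP C.
  by rewrite !hE => /eqP; rewrite to_orbit_act // => /eqP.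
by exists (perm injh) => _ y; rewrite permE hE.
Qed.

Definition orbit_perm (g : {perm V}) : {perm orbits P} := sval (orbit_perm_subproof g).

Lemma orbit_permE g x : g \in G -> orbit_perm g (pi x) = pi (g x).
Proof. by move=> Gg; apply: (svalP (orbit_perm_subproof g)). Qed.

Lemma orbit_permM : {in G &, {morph orbit_perm : g h / g * h}}.
Proof.
move=> g h Gg Gh; apply/permP=> B; have [x ->] := to_orbitP B.
by rewrite [RHS]permM !orbit_permE ?groupM // permM.
Qed.

Canonical orbit_perm_morphism := Morphism orbit_permM.

(** Uniqueness of lifts: an element preserving every orbit is corrected by P to fix a vertex, and
    local injectivity of the projection spreads the fixed points along edges. *)
Lemma ker_orbit_perm : 'ker orbit_perm = P.
Proof.
have sPG := pHall_sub sylP; apply/eqP; rewrite eqEsubset; apply/andP; split; last first.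
  apply/subsetP=> g Pg; have Gg := subsetP sPG g Pg; apply/kerP=> //.
  apply/permP=> B; have [x ->] := to_orbitP B; rewrite perm1 orbit_permE //.
  by apply/eqP; rewrite to_orbit_eq -[g x]/('P%act x g) mem_orbit.
apply/subsetP=> g /[dup] kg /morphpreP[Gg _]; have [v _] := v0_exists.
have gB x : pi (g x) = pi x by rewrite -orbit_permE // (mker kg) perm1.
have /eqP := gB v; rewrite to_orbit_eq => /orbitP[h Ph hv].
have Gh := subsetP sPG h Ph; suff : g * h^-1 = 1.
  by move/(canRL (mulgKV _)); rewrite mul1g => ->.
have Ggh : g * h^-1 \in G by rewrite groupM ?groupV.
have ghB x : pi ((g * h^-1) x) = pi x.
  rewrite permM -[RHS]gB; apply/eqP; rewrite to_orbit_eq.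
  by rewrite -[_ (g x)]/('P%act (g x) h^-1) mem_orbit ?groupV.
apply/permP=> x; rewrite perm1; apply/eqP.
apply: (@connected_ind [pred y | (g * h^-1) y == y] v) x => [u y /= /eqP ghu euy|].
  apply/eqP; apply: (to_orbit_nbhd_inj (v := u)) => //; last by rewrite inE.
  by rewrite inE -{1}ghu graph_autE.
by rewrite /= permM -hv /= apermE permK.
Qed.

Lemma orbit_perm_aut : orbit_perm @* G \subset graph_aut Q.
Proof.
apply/subsetP=> _ /morphimP[g _ Gg ->]; rewrite inE.
apply/'forall_'forall_eqP => B C; have [x ->] := to_orbitP B; have [y ->] := to_orbitP C.
rewrite !orbit_permE //; apply/quotient_graphP/quotient_graphP=> [[z pz gz]|[z pz xz]].
  exists (g^-1 z); last by rewrite -(graph_autE _ _ Gg) permKV.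
  by apply/eqP; rewrite -(to_orbit_act _ _ Gg) permKV pz.
by exists (g z); [apply/eqP; rewrite to_orbit_act ?pz | rewrite graph_autE].
Qed.

Lemma orbit_perm_arc_transitive : arc_transitive Q (orbit_perm @* G).
Proof.
move=> B1 B2 C1 C2; have [x1 ->] := to_orbitP B1; have [x2 ->] := to_orbitP B2.
have [y1 ->] := to_orbitP C1; have [y2 ->] := to_orbitP C2.
case/quotient_graphP=> z <- xz /quotient_graphP[t <- yt].
have [g [Gg <- <-]] := arcG xz yt; exists (orbit_perm g).
by rewrite !orbit_permE //; split=> //; apply: mem_morphim.
Qed.

(** An element fixing the orbit of v differs by an element of P from one fixing v, and both act
    alike on orbits; the projection is a bijection on neighbourhoods. *)
Lemma orbit_perm_locally (W : finType) (L : {group {perm W}}) :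
  locally e G L -> locally Q (orbit_perm @* G)%G L.
Proof.
case=> v /(locally_atP _ _ sGaut)[f [injf imf GL LG]]; exists (pi v).
have fv w : f w \in nbhd e v by rewrite -imf imset_f ?inE.
have [_ imQ] := regular_covering v.
apply/(locally_atP _ _ orbit_perm_aut); exists (pi \o f); split.
- by move=> w w' /(to_orbit_nbhd_inj (fv w) (fv w'))/injf.
- by rewrite imset_comp imf.
- move=> _ /setIP[/morphimP[g _ Gg ->] /astab1P /=].
  rewrite apermE orbit_permE // => /eqP; rewrite to_orbit_eq => /orbitP[h Ph hv].
  have Gh := subsetP (pHall_sub sylP) h Ph.
  have Ggh : g * h^-1 \in G by rewrite groupM ?groupV.
  have [|s Ls hs] := GL (g * h^-1).
    by rewrite inE Ggh; apply/astab1P; rewrite /= apermE permM -hv /= apermE permK.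
  exists s => // w /=; rewrite -hs orbit_permE //; apply/eqP.
  by rewrite permM eq_sym to_orbit_eq -[_ (g _)]/('P%act _ h^-1) mem_orbit ?groupV.
move=> s Ls; have [g /setIP[Gg /astab1P gv] gs] := LG s Ls.
exists (orbit_perm g); last by move=> w /=; rewrite orbit_permE // gs.
rewrite inE mem_morphim //=; apply/astab1P.
by rewrite /= apermE orbit_permE // -[g v]/('P%act v g) gv.
Qed.

Lemma quotient_action (W : finType) (L : {group {perm W}}) : locally e G L ->
  exists phi : {morphism G / P >-> {perm (orbits P)}},
    [/\ natural_action phi, 'injm phi,
        phi @* (G / P) \subset graph_aut Q,
        arc_transitive Q (phi @* (G / P))
      & locally Q (phi @* (G / P))%G L].
Proof.
move=> locL; have nPG : G \subset 'N(P) by rewrite normal_norm ?Sylow_normal.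
have sker : 'ker (coset P) \subset 'ker orbit_perm by rewrite ker_coset ker_orbit_perm.
pose phi := factm_morphism sker nPG; exists phi.
have im : (phi @* (G / P))%G = (orbit_perm @* G)%G.
  by apply: val_inj; apply: morphim_factm.
rewrite -[phi @* (G / P)]/(gval (phi @* (G / P))%G) im; split.
- move=> g x Gg; have -> : phi (coset P g) = orbit_perm g by apply: factmE.
  exact: orbit_permE.
- by apply/injm_factmP; rewrite ker_coset ker_orbit_perm.
- exact: orbit_perm_aut.
- exact: orbit_perm_arc_transitive.
- exact: orbit_perm_locally.
Qed.

End QuotientGraph.
End ArcTransitive.

(** * Structure of locally quasiprimitive graphs of order k p or k p^2 *)

Theorem theorem2
  (W : finType) (L : {group {perm W}}) (d c k p alpha : nat)
  (V : finType) (e : rel V) (G P : {group {perm V}})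
  (hd : #|W| = d) (hd3 : (3 <= d)%N)
  (hLqp : quasiprimitive L) (hLgr : graph_restrictive L c)
  (hk : (0 < k)%N) (hp : prime p) (hpkc : (k * c <= p)%N)
  (halpha : alpha = 1%N \/ alpha = 2%N)
  (hGamma : connected_simple_graph e) (hV : #|V| = (k * p ^ alpha)%N)
  (hG : G \subset graph_aut e) (hGarc : arc_transitive e G)
  (hGloc : locally e G L)
  (hP : p.-Sylow(G) P) :
  [/\ (* (a) *)
      [/\ P <| G, #|P| = (p ^ alpha)%N & semiregular_perm_group P],
      (* (b) *)
      (3 <= k)%N ->
      [/\ connected_simple_graph (quotient_graph e P),
          regular_covering_projection e P,
          #|orbits P| = k
        & exists phi : {morphism G / P >-> {perm (orbits P)}},
            [/\ natural_action phi,
                'injm phi,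
                phi @* (G / P) \subset graph_aut (quotient_graph e P),
                arc_transitive (quotient_graph e P) (phi @* (G / P))
              & locally (quotient_graph e P) (phi @* (G / P))%G L]],
      (* (c) *)
      forall v : V, exists H : {group {perm {perm V}}},
        H \subset Aut P /\ 'C_G[v | 'P] \isog H
    & (* (d) *)
      prime d /\
      ([/\ cyclic P,
           p = 1 %[mod (2 * d)%N],
           forall v : V, locally_at e G (cyclic_perm_group d) v,
           #|G / P| = (k * d)%N
         & (G / P) / [~: G / P, G / P] \isog Zp (2 * d)%N]
       \/
       [/\ alpha = 2%N,
           p.-abelem P,
           #|P| = (p ^ 2)%N
         & (forall v : V, locally_at e G (cyclic_perm_group d) v) \/
           (forall v : V, locally_at e G (dihedral_perm_group d) v)])].
Proof.
have [trL grL] := hLgr.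
have locG := locally_at_all hGamma hG hGarc hGloc.
have qpG v : quasiprimitive_on (local_group e G v) (nbhd e v).
  exact: perm_isomorphic_quasiprimitive trL hLqp (locG v).
have cardN v : #|nbhd e v| = d.
  by have [f [_ [injf <- _ _]]] := locG v; rewrite card_imset // cardsT.
have stab_le v : (#|'C_G[v | 'P]| <= c)%N by apply: grL hGamma hG hGarc hGloc v.
have hd2 : (2 < d)%N := hd3.
have nPG := Sylow_normal hGamma hG hGarc qpG cardN hd2 stab_le hk hp hpkc hV hP.
have cP := card_Sylow_arc_transitive hGamma hG hGarc qpG cardN hd2 stab_le hk hp hpkc hV hP.
have cyc := cyclic_Sylow_case hGamma hG hGarc qpG cardN hd2 stab_le hk hp hpkc halpha hV hP.
have ncyc := noncyclic_Sylow_case hGamma hG hGarc qpG cardN hd2 stab_le hk hp hpkc halpha hV hP.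
have [v _] := hGloc.
have prd : prime d.
  by have [/cyc[]//|/ncyc/(_ v)[]] := boolP (cyclic P).
split.
- by split=> //; apply: Sylow_semiregular cardN hd2 stab_le hk hp hpkc hV hP.
- move=> k3; split.
  + exact: connected_quotient cardN hd2 stab_le hk hp hpkc hV hP k3.
  + exact: regular_covering cardN hd2 stab_le hk hp hpkc hV hP prd k3.
  + exact: card_orbits_Sylow cardN hd2 stab_le hk hp hpkc hV hP.
  + exact: quotient_action cardN hd2 stab_le hk hp hpkc hV hP prd k3 _ _ hGloc.
- exact: stab_isog_Aut_Sylow cardN hd2 stab_le hk hp hpkc halpha hV hP.
split=> //; have [cycP|ncycP] := boolP (cyclic P).
  by left; have [_ ? ? ? ?] := cyc cycP; split.
right; split.
- exact: noncyclic_alpha2 cardN hd2 stab_le hk hp hpkc halpha hV hP ncycP.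
- exact: noncyclic_abelem cardN hd2 stab_le hk hp hpkc halpha hV hP ncycP.
- exact: noncyclic_card cardN hd2 stab_le hk hp hpkc halpha hV hP ncycP.
by have [_ [] locv] := ncyc ncycP v; [left|right]; apply: locally_at_all => //; exists v.
Qed.
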